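(* Let $M_1>0$ and $M_2>0$, and let $G:\mathbb{R}\to\mathbb{R}$ be a measurable function that is not a.e. constant, such that $G(M_1+\cdot\times M_2)\in L^2(\gamma)$ and $G(-M_1+\cdot\times M_2)\in L^2(\gamma)$. Then the set $$E=\{(x,y)\in(-M_1,M_1)\times(0,M_2):\ G(x+\cdot\times y)\text{ has Hermite rank}\ \ge 2\}$$ has Hausdorff dimension not exceeding $1$. In particular, $E$ has two-dimensional Lebesgue measure $0$.
   Context: $\gamma(dx)=\phi(x)\,dx$ with $\phi(x)=(2\pi)^{-1/2}e^{-x^2/2}$ is the standard Gaussian measure on $\mathbb{R}$, and $L^2(\gamma)=\{G:\int_{\mathbb{R}}G(z)^2\phi(z)\,dz<\infty\}$. $G(x+\cdot\times y)$ denotes the function $z\mapsto G(x+yz)$. ''a.e.'' is with respect to Lebesgue measure. The Hermite polynomials are $H_0(x)=1$ and $H_m(x)=(-1)^m e^{x^2/2}\frac{d^m}{dx^m}e^{-x^2/2}$ for $m\ge1$ (so $H_1(x)=x$, $H_2(x)=x^2-1$). The Hermite rank of $f\in L^2(\gamma)$ is $\inf\{m\ge 1:\int_{\mathbb{R}} f(x)H_m(x)\,\gamma(dx)\ne 0\}$ (with $\inf\emptyset=\infty$). *)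

(* Defs.v *)
From HB Require Import structures.
From mathcomp Require Import all_boot all_order all_algebra.
From mathcomp Require Import all_classical all_reals all_analysis.

Set Implicit Arguments.
Unset Strict Implicit.
Unset Printing Implicit Defensive.
Import Order.TTheory GRing.Theory Num.Theory.
Import numFieldNormedType.Exports.
Local Open Scope classical_set_scope.
Local Open Scope ring_scope.

(* For m = 0 the Rodrigues formula gives the constant 1, see [hermite0]. *)
Definition hermite {R : realType} (m : nat) (x : R) : R :=
  (-1) ^+ m * expR (x ^+ 2 / 2)
  * derive1n m (fun t : R => expR (- (t ^+ 2 / 2))) x.

(* The rank lives in \bar R so that it is +oo (the infimum of the empty set)
   when all the coefficients of positive order vanish.  It is meaningful for f
   in L^2(gamma), where gamma = normal_prob 0 1. *)
Definition hermite_rank {R : realType} (f : R -> R) : \bar R :=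
  ereal_inf [set (m%:R : R)%:E | m in [set m : nat | (1 <= m)%N /\
    (\int[normal_prob 0 1]_x (f x * hermite m x)%:E)%E <> 0%E]].

Definition rescale {R : realType} (G : R -> R) (x y : R) : R -> R :=
  fun z => G (x + y * z).

Section Hausdorff.
Context {R : realType} {T : Type} (dist : T -> T -> R).
Local Open Scope ereal_scope.

(* The maximum with 0 only matters for the empty set. *)
Definition diam (U : set T) : \bar R :=
  maxe 0 (ereal_sup [set (dist p.1 p.2)%:E | p in U `*` U]).

(* The library has 0 `^ 0 = 1; a point must have weight 1 for s = 0, but the
   empty set must not, hence the case distinction. *)
Definition hausdorff_weight (s : R) (U : set T) : \bar R :=
  if U == set0 then 0 else diam U `^ s.

Definition hausdorff_content (s delta : R) (A : set T) : \bar R :=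
  ereal_inf [set \sum_(0 <= i <oo) hausdorff_weight s (U i) |
    U in [set U : nat -> set T |
            A `<=` \bigcup_i U i /\ forall i, diam (U i) <= delta%:E]].

Definition hausdorff_measure (s : R) (A : set T) : \bar R :=
  ereal_sup [set hausdorff_content s delta A |
    delta in [set delta : R | (0 < delta)%R]].

Definition hausdorff_dim (A : set T) : \bar R :=
  ereal_inf [set s%:E |
    s in [set s : R | (0 <= s)%R /\ hausdorff_measure s A = 0]].

End Hausdorff.

(* The library's metric on R * R is the sup metric. *)
Definition euclidean_dist {R : realType} (p q : R * R) : R :=
  Num.sqrt ((p.1 - q.1) ^+ 2 + (p.2 - q.2) ^+ 2).

Lemma hermite0 (R : realType) (x : R) : hermite 0 x = 1.
Proof. by rewrite /hermite expr0 mul1r /= -expRD subrr expR0. Qed.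

(* Main.v *)
Require Import Defs.
From HB Require Import structures.
From mathcomp Require Import all_boot all_order all_algebra.
From mathcomp Require Import all_classical all_reals all_analysis measurable_realfun.
From mathcomp Require Import ring lra.
Import Order.TTheory GRing.Theory Num.Theory.
Import numFieldNormedType.Exports.
Local Open Scope classical_set_scope.
Local Open Scope ring_scope.

(** The substitution u = x + y z turns the first Hermite coefficient of
    G(x + y z), up to a nonzero factor, into I_1(x, y), where I_j(x, y) is the
    integral of G(u) (u - x)^j exp(-(u - x)^2 / (2 y^2)) du ([gauss_moment]).  So E
    is contained in the set of zeros of I_1.  The square integrability of G at scale
    M2 makes |G(u)| exp(-c u^2) integrable for some c < 1 / (2 M2^2), and below the
    scale M2 this leaves a Gaussian margin, by which all the I_j are bounded and
    can be differentiated under the integral.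

    Formally I_1 is y^2 times a Gaussian average of the derivative of G.  This
    suggests the functions g_k = I_(k+1) - k y^2 I_(k-1) ([gradient_moment]),
    which are y^2 times the I_k of that derivative: g_0 = I_1, and the derivative
    of g_k in x is y^-2 g_(k+1) - k g_(k-1).  If all the g_k vanish at one point
    (x, y), then G minus some constant has vanishing moments of all orders for
    the normal law of mean x and standard deviation y ([gradient_moment_all0]).
    Because of the margin, moments determine a function
    ([vanishing_moments_ae0]), and G would be constant almost everywhere.

    So at every point of E there is a first k such that g_(k+1) does not vanish.
    There g_k = 0 while its derivative in x is not 0.  By the mean value theorem
    in x and a Lipschitz bound in y, the zeros of this kind satisfy
    |x - x'| <= K |y - y'| locally ([gradient_moment_zeros_graph]).  Once lower
    bounds on y and on |g_(k+1)| are fixed, K and the size of the neighbourhood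
    are uniform, so E is covered by countably many bounded sets that are
    Lipschitz graphs over subsets of the y-axis.  Each of them is null for the Hausdorff
    measure of every dimension s > 1 ([lipschitz_graph_hausdorff_null]), hence so
    is E.  The dimension bound follows, and s = 2 gives the statement on Lebesgue
    measure, as a set of diameter d lies in a square of area 4 d^2. *)

(** * Integrals against normal laws and affine changes of variables *)

(** Both sides are measures, so half-open intervals suffice. *)
Lemma lebesgue_measure_affine (R : realType) (a s : R) (A : set R) :
  0 < s -> measurable A ->
  pushforward lebesgue_measure
    (fun z : measurableTypeR R => a + s * z : measurableTypeR R) A =
  (s^-1%:E * lebesgue_measure A)%E.
Proof.
move=> s0 mA.
have mphi : measurable_fun setT
    (fun z : measurableTypeR R => a + s * z : measurableTypeR R).
  by apply: measurable_funD => //; exact: measurable_funM.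
have s0' : 0 <= s by exact: ltW.
pose push : {measure set (measurableTypeR R) -> \bar R} :=
  measure_function_pushforward__canonical__measure_function_Measure
    lebesgue_measure mphi.
pose nu := mscale (NngNum s0') push.
suff -> : lebesgue_measure A = nu A.
  by rewrite /nu /mscale/= muleA -EFinM mulVf ?gt_eqF// mul1e.
apply: lebesgue_measure_unique => // _ [[p q]] _ <-.
transitivity (s%:E * lebesgue_measure (`](p - a) / s, (q - a) / s]%classic)%R)%E;
  last first.
  congr (_ * lebesgue_measure _)%E.
  apply/seteqP; split => z /=; rewrite !in_itv/= ltr_pdivrMr// ler_pdivlMr//;
  by move=> /andP[? ?]; apply/andP; split; lra.
rewrite !lebesgue_measure_itv/= !lte_fin ltr_pM2r ?invr_gt0// ltrD2r.
case: ifP => _; last by rewrite mule0.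
by rewrite -!EFinD -EFinM; congr EFin; field; rewrite gt_eqF.
Qed.

Lemma ge0_integral_affine (R : realType) (a s : R) (f : R -> \bar R) :
  0 < s -> measurable_fun setT f -> (forall x, 0 <= f x)%E ->
  (\int[lebesgue_measure]_z f (a + s * z)%R =
   s^-1%:E * \int[lebesgue_measure]_u f u)%E.
Proof.
move=> s0 mf f0.
have mphi : measurable_fun setT
    (fun z : measurableTypeR R => a + s * z : measurableTypeR R).
  by apply: measurable_funD => //; exact: measurable_funM.
have := @ge0_integral_pushforward _ _ _ _ _ _ mphi lebesgue_measure setT f
  measurableT mf (fun x _ => f0 x).
rewrite preimage_setT => <-.
have s0' : 0 <= s^-1 by rewrite invr_ge0 ltW.
rewrite -(@ge0_integral_mscale _ _ _ _ _ measurableT (NngNum s0')) //.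
apply: eq_measure_integral => A mA _ /=.
exact: lebesgue_measure_affine.
Qed.

(** The normal law is given as a set function; its Radon-Nikodym derivative
    agrees almost everywhere with the explicit density, which turns integrals
    against it into Lebesgue integrals. *)
Lemma ge0_integral_normal_prob (R : realType) (m s : R) (f : R -> \bar R) :
  measurable_fun setT f -> (forall x, 0 <= f x)%E ->
  (\int[normal_prob m s]_x f x =
   \int[lebesgue_measure]_x (f x * (normal_pdf m s x)%:E))%E.
Proof.
move=> mf f0.
have dom := @normal_prob_dominates R m s.
rewrite -(Radon_Nikodym_SigmaFinite.change_of_variables dom)//.
have fi := Radon_Nikodym_SigmaFinite.f_integrable dom.
apply: ae_eq_integral => //.
- by apply: emeasurable_funM => //; exact: measurable_int fi.
- by apply: emeasurable_funM => //; apply/measurable_EFinP; exact: measurable_normal_pdf.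
- apply: ae_eqe_mul2l; apply: integral_ae_eq => //.
  + by apply/measurable_EFinP; exact: measurable_normal_pdf.
  + by move=> E _ mE; rewrite -Radon_Nikodym_SigmaFinite.f_integral.
Qed.

Lemma integral_normal_prob (R : realType) (m s : R) (f : R -> R) :
  measurable_fun setT f ->
  (\int[normal_prob m s]_x (f x)%:E =
   \int[lebesgue_measure]_x (f x * normal_pdf m s x)%:E)%E.
Proof.
move=> mf.
have mf' : measurable_fun setT (EFin \o f) by exact/measurable_EFinP.
rewrite [LHS]integralE [RHS]integralE !ge0_integral_normal_prob //.
- congr (_ - _)%E; apply: eq_integral => x _.
    by rewrite !funeposE/= -!EFin_max -EFinM maxr_pMl ?normal_pdf_ge0// mul0r.
  by rewrite !funenegE/= -!EFin_max -EFinM maxr_pMl ?normal_pdf_ge0// mul0r mulNr.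
- exact: measurable_funeneg.
- exact: measurable_funepos.
Qed.

Lemma integral_affine (R : realType) (a s : R) (f : R -> R) :
  0 < s -> lebesgue_measure.-integrable setT (EFin \o f) ->
  (\int[lebesgue_measure]_z (f (a + s * z)%R)%:E =
   s^-1%:E * \int[lebesgue_measure]_u (f u)%:E)%E.
Proof.
move=> s0 fi; have mf := measurable_int _ fi.
rewrite [in RHS]integralE.
have := @ge0_integral_affine _ a _ _ s0 (measurable_funepos mf) (fun _ => funepos_ge0 _ _).
have := @ge0_integral_affine _ a _ _ s0 (measurable_funeneg mf) (fun _ => funeneg_ge0 _ _).
move=> hp hn.
rewrite -[LHS]/(\int[lebesgue_measure]_z ((EFin \o f) \o (fun z => a + s * z)%R) z)%E.
rewrite [LHS]integralE.
under [X in (X - _)%E]eq_integral do rewrite funepos_comp/=.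
under [X in (_ - X)%E]eq_integral do rewrite funeneg_comp/=.
rewrite hn hp.
apply/esym/muleBr => //; apply: fin_num_adde_defl; rewrite fin_numN.
exact: integrable_neg_fin_num.
Qed.

Lemma Rintegral_affine (R : realType) (a s : R) (f : R -> R) :
  0 < s -> lebesgue_measure.-integrable setT (EFin \o f) ->
  \int[lebesgue_measure]_z f (a + s * z) =
   s^-1 * \int[lebesgue_measure]_u f u.
Proof.
move=> s0 fi; rewrite /Rintegral integral_affine// fineM//.
exact: integrable_fin_num.
Qed.

(** * Functions all of whose moments vanish *)

(** Polynomials cost an arbitrarily small part of a Gaussian margin. *)
Lemma poly_le_expR_sqr (R : realType) (p : {poly R}) (eta : R) : 0 < eta ->
  exists2 C : R, 0 <= C & forall x, `|p.[x]| <= C * expR (eta * x ^+ 2).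
Proof.
elim/poly_ind: p eta => [|p c IH] eta eta0.
  by exists 0 => // x; rewrite horner0 normr0 mul0r.
have eta2 : 0 < eta / 2 by lra.
have [C C0 HC] := IH _ eta2.
exists (C * (1 + (eta / 2)^-1) + `|c|).
  by rewrite addr_ge0// mulr_ge0// addr_ge0// invr_ge0 ltW.
move=> x; rewrite hornerMXaddC (le_trans (ler_normD _ _))// mulrDl lerD//; last first.
  by rewrite ler_peMr// (le_trans _ (expR_ge1Dx _))// lerDl mulr_ge0 ?sqr_ge0 ?ltW.
rewrite normrM (_ : eta * x ^+ 2 = eta / 2 * x ^+ 2 + eta / 2 * x ^+ 2); last by field.
rewrite expRD mulrACA ler_pM//.
apply: (@le_trans _ _ ((1 + (eta / 2)^-1) * (1 + eta / 2 * x ^+ 2))); last first.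
  by rewrite ler_wpM2l ?expR_ge1Dx// addr_ge0// invr_ge0 ltW.
rewrite mulrDl mul1r mulrDr mulr1 mulKf ?gt_eqF//.
have i0 : 0 < (eta / 2)^-1 by rewrite invr_gt0.
have e0 : 0 <= eta / 2 * x ^+ 2 by rewrite mulr_ge0 ?sqr_ge0 ?ltW.
have : `|x| <= 1 + x ^+ 2 by rewrite -real_normK ?num_real//; nra.
by lra.
Qed.

(** The form of dominated convergence used below: a dominated limit of functions
    of integral zero has integral zero. *)
Lemma dominated_vanishing (R : realType) (f_ : nat -> R -> R) (f g : R -> R) :
  (forall n, measurable_fun setT (f_ n)) -> measurable_fun setT f ->
  {ae lebesgue_measure, forall x, f_ ^~ x @ \oo --> f x} ->
  lebesgue_measure.-integrable setT (EFin \o g) ->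
  (forall n x, `|f_ n x| <= g x) ->
  (forall n, \int[lebesgue_measure]_x (f_ n x)%:E = 0)%E ->
  (\int[lebesgue_measure]_x (f x)%:E = 0)%E.
Proof.
move=> mf_ mf f_f ig le_g f_0.
have [|||||_ _] := @dominated_convergence _ _ _ lebesgue_measure setT measurableT
   (fun n => EFin \o f_ n) (EFin \o f) (EFin \o g).
- by move=> n; apply/measurable_EFinP; exact: mf_.
- exact/measurable_EFinP.
- apply: (@filterS _ _ (@ae_filter_ringOfSetsType _ _ _ lebesgue_measure)) f_f => x f_f _ /=.
  by apply/fine_cvgP; split => //; exact: nearW.
- by [].
- by apply: aeW => x n _ /=; rewrite lee_fin.
move/cvg_lim => <- //=.
by under eq_fun do rewrite f_0; apply: lim_cst.
Qed.

Lemma le_series_expR (R : realType) (x : R) n :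
  `|series (exp_coeff x) n| <= expR `|x|.
Proof.
apply: (@le_trans _ _ (series (exp_coeff `|x|) n)).
  rewrite /series/= (le_trans (ler_norm_sum _ _ _))// ler_sum// => i _.
  by rewrite /exp_coeff/= normrM normrX normfV normr_nat.
rewrite /expR; apply: nondecreasing_cvgn_le; last exact: is_cvg_series_exp_coeff.
apply/nondecreasing_series => i _ _; exact: exp_coeff_ge0.
Qed.

Lemma measurable_horner (R : realType) (p : {poly R}) :
  measurable_fun setT (fun x : R => p.[x]).
Proof. by apply: continuous_measurable_fun; exact: continuous_horner. Qed.

(** The partial sums of the exponential series of q are polynomials, bounded by
    exp |q|, and the Gaussian margin eps dominates exp |q|: the vanishing of all
    moments passes from h to h exp(q). *)
Lemma vanishing_moments_expR (R : realType) (h : R -> R) (eps C : R) (q : {poly R}) :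
  0 < eps -> measurable_fun setT h ->
  lebesgue_measure.-integrable setT (EFin \o (fun x => `|h x| * expR (eps * x ^+ 2))) ->
  (forall x, `|q.[x]| <= eps / 2 * x ^+ 2 + C) ->
  (forall p : {poly R}, \int[lebesgue_measure]_x (h x * p.[x])%:E = 0)%E ->
  forall p : {poly R},
    (\int[lebesgue_measure]_x (h x * expR q.[x] * p.[x])%:E = 0)%E.
Proof.
move=> eps0 mh ih le_q h0 p.
have [D D0 HD] := @poly_le_expR_sqr _ p (eps / 2) ltac:(lra).
pose S n : {poly R} := \sum_(0 <= k < n) (k`!%:R^-1)%:P * q ^+ k.
have SE n x : (S n).[x] = series (exp_coeff q.[x]) n.
  rewrite /S horner_sum /series/=; apply: eq_bigr => k _.
  by rewrite hornerCM horner_exp mulrC.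
pose g x := (D * expR C) * (`|h x| * expR (eps * x ^+ 2)).
apply: (@dominated_vanishing _ (fun n x => h x * (S n * p).[x]) _ g).
- by move=> n; apply: measurable_funM => //; exact: measurable_horner.
- apply: measurable_funM; last exact: measurable_horner.
  apply: measurable_funM => //; apply: measurableT_comp => //.
  exact: measurable_horner.
- apply: aeW => x /=.
  under eq_fun do rewrite hornerM SE mulrA.
  apply: cvgMl; apply: cvgMr; exact: is_cvg_series_exp_coeff.
- rewrite /g; have -> : EFin \o g =
      (fun x => (D * expR C)%:E * (`|h x| * expR (eps * x ^+ 2))%:E)%E.
    by apply/funext => x /=; rewrite -EFinM.
  exact: integrableZl.
- move=> n x; rewrite /g normrM mulrCA ler_wpM2l// hornerM normrM.
  have -> : D * expR C * expR (eps * x ^+ 2) =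
      expR (eps / 2 * x ^+ 2 + C) * (D * expR (eps / 2 * x ^+ 2)).
    rewrite (_ : eps * x ^+ 2 = eps / 2 * x ^+ 2 + eps / 2 * x ^+ 2); last by field.
    by rewrite !expRD; ring.
  rewrite ler_pM// (le_trans _ (_ : expR `|q.[x]| <= _))//.
    by rewrite SE le_series_expR.
  by rewrite ler_expR.
- by move=> n; exact: h0.
Qed.

(** A single use of [vanishing_moments_expR] reaches only exponents that are small
    against eps, but h w satisfies the same hypotheses as h when 0 <= w <= 1, so the step can
    be repeated: all the powers of w are reached, however peaked. *)
Lemma vanishing_moments_gauss (R : realType) (h : R -> R) (eps delta a : R) :
  0 <= delta -> 4 * delta <= eps -> 0 < eps -> measurable_fun setT h ->
  lebesgue_measure.-integrable setT (EFin \o (fun x => `|h x| * expR (eps * x ^+ 2))) ->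
  (forall p : {poly R}, \int[lebesgue_measure]_x (h x * p.[x])%:E = 0)%E ->
  forall n (p : {poly R}), (\int[lebesgue_measure]_x
    (h x * expR (- (delta * (x - a) ^+ 2)) ^+ n * p.[x])%:E = 0)%E.
Proof.
move=> delta0 deps eps0 mh ih h0; elim=> [p|n IH].
  by under eq_integral do rewrite expr0 mulr1; exact: h0.
set w := fun x => expR (- (delta * (x - a) ^+ 2)).
have mw : measurable_fun setT w.
  apply: measurableT_comp => //; apply: measurableT_comp => //.
  apply: measurable_funM => //; apply: measurable_funX.
  exact: measurable_funB.
have w0 x : 0 <= w x by exact: expR_ge0.
have w1 x : w x <= 1.
  by rewrite expR_le1 oppr_le0 mulr_ge0// sqr_ge0.
have mhn : measurable_fun setT (fun x => h x * w x ^+ n).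
  by apply: measurable_funM => //; exact: measurable_funX.
pose q : {poly R} := (- delta) *: ('X - a%:P) ^+ 2.
have qE x : q.[x] = - (delta * (x - a) ^+ 2).
  by rewrite /q hornerZ horner_exp hornerXsubC mulNr.
have := @vanishing_moments_expR _ _ _ (2 * delta * a ^+ 2) q eps0 mhn.
move=> H p; rewrite -[RHS](H _ _ IH p).
- by apply: eq_integral => x _; rewrite qE exprSr mulrA.
- apply: le_integrable ih => //.
  + apply/measurable_EFinP; apply: measurable_funM.
      exact: measurableT_comp.
    apply: measurableT_comp => //; apply: measurable_funM => //.
  + move=> x _ /=; rewrite lee_fin !normrM normr_id ler_wpM2r// normr_id.
    by rewrite ler_piMr// ger0_norm ?exprn_ge0// exprn_ile1.
- move=> x; rewrite qE normrN ger0_norm; last by rewrite mulr_ge0// sqr_ge0.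
  by have := sqr_ge0 x; have := sqr_ge0 (x + a); nra.
Qed.

Lemma le_bernoulli (R : realType) (t : R) n : -1 <= t -> 1 + n%:R * t <= (1 + t) ^+ n.
Proof.
move=> t1; elim: n => [|n IH]; first by rewrite mul0r addr0 expr0.
rewrite exprS (@le_trans _ _ ((1 + t) * (1 + n%:R * t)))//; last first.
  by rewrite ler_wpM2l//; lra.
rewrite -natr1; have : 0 <= n%:R * t ^+ 2 by rewrite mulr_ge0 ?sqr_ge0.
by lra.
Qed.

(** Together with [threshold_cvg0]: 1 - (1 - v^n)^(2^n) is a sequence of
    polynomials in v that converges boundedly on [0, 1], except at v = 1/2, to
    the indicator function of v > 1/2.  Here 2^n v^n tends to 0 and Bernoulli's
    inequality applies. *)
Lemma threshold_cvg1 (R : realType) (v : R) : 0 <= v -> v < 2^-1 ->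
  (1 - v ^+ n) ^+ (2 ^ n) @[n --> \oo] --> (1 : R).
Proof.
move=> v0 v2.
apply: (@squeeze_cvgr _ _ _ _ (fun n => 1 - (2 * v) ^+ n) (cst 1)); last 2 first.
- rewrite -[X in _ --> X]subr0; apply: cvgB; first exact: cvg_cst.
  by apply: cvg_expr; rewrite ger0_norm; lra.
- exact: cvg_cst.
apply: nearW => n /=.
have vn0 : 0 <= v ^+ n by rewrite exprn_ge0.
have vn1 : v ^+ n <= 1 by rewrite exprn_ile1//; lra.
rewrite exprn_ile1 ?andbT; try lra.
rewrite exprMn -natrX -mulrN; apply: le_bernoulli; lra.
Qed.

(** Since (1 - t)^m (1 + t)^m <= 1, Bernoulli's inequality bounds (1 - t)^m by
    1 / (1 + m t), and 2^n v^n tends to infinity. *)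
Lemma threshold_cvg0 (R : realType) (v : R) : v <= 1 -> 2^-1 < v ->
  (1 - v ^+ n) ^+ (2 ^ n) @[n --> \oo] --> (0 : R).
Proof.
move=> v1 v2.
apply: (@squeeze_cvgr _ _ _ _ (cst 0) (fun n => (2 * v)^-1 ^+ n)); last 2 first.
- exact: cvg_cst.
- apply: cvg_expr; rewrite ger0_norm ?invr_ge0 ?invf_lt1; lra.
apply: nearW => n /=.
have vn0 : 0 < v ^+ n by rewrite exprn_gt0//; lra.
have vn1 : v ^+ n <= 1 by rewrite exprn_ile1//; lra.
rewrite exprn_ge0 ?subr_ge0//=.
rewrite exprVn -[leRHS]mul1r ler_pdivlMr; last by rewrite exprn_gt0//; lra.
have : 1 + (2 ^ n)%:R * v ^+ n <= (1 + v ^+ n) ^+ (2 ^ n).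
  by apply: le_bernoulli; lra.
rewrite exprMn -natrX => H.
apply: (@le_trans _ _ ((1 - v ^+ n) ^+ (2 ^ n) * (1 + v ^+ n) ^+ (2 ^ n))).
  rewrite ler_wpM2l ?exprn_ge0 ?subr_ge0//.
  by rewrite (le_trans _ H)// lerDr.
rewrite -exprMn exprn_ile1//; nra.
Qed.

Lemma integral_comp_horner0 (R : realType) (h w : R -> R) (p : {poly R}) :
  (forall n, lebesgue_measure.-integrable setT (EFin \o (fun x => h x * w x ^+ n))) ->
  (forall n, \int[lebesgue_measure]_x (h x * w x ^+ n)%:E = 0)%E ->
  (\int[lebesgue_measure]_x (h x * p.[w x])%:E = 0)%E.
Proof.
move=> ih h0.
transitivity (\int[lebesgue_measure]_x
    (\sum_(i <- iota 0 (size p)) (p`_i)%:E * (h x * w x ^+ i)%:E))%E.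
  apply: eq_integral => x _; rewrite horner_coef mulr_sumr sumEFin.
  rewrite -(big_mkord xpredT (fun i => h x * (p`_i * w x ^+ i))) /index_iota subn0.
  by congr EFin; apply: eq_bigr => i _; ring.
rewrite integral_sum//; last by move=> i; apply: integrableZl => //; exact: ih.
rewrite big1// => i _; rewrite integralZl//; last exact: ih.
by rewrite h0 mule0.
Qed.

Lemma cvgM_onem (R : realType) (c : R) (u : nat -> R) (l : R) :
  u n @[n --> \oo] --> l -> c * (1 - u n) @[n --> \oo] --> c * (1 - l).
Proof. by move=> ul; apply: cvgM; [exact: cvg_cst | apply: cvgB; [exact: cvg_cst|]]. Qed.

(** Polynomials in the weight exp(-delta (x - a)^2) integrate to zero against h
    by [vanishing_moments_gauss], and they approximate the indicator function of
    any ball centred at a. *)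
Lemma vanishing_moments_ball (R : realType) (h : R -> R) (eps : R) :
  0 < eps -> measurable_fun setT h ->
  lebesgue_measure.-integrable setT (EFin \o (fun x => `|h x| * expR (eps * x ^+ 2))) ->
  (forall p : {poly R}, \int[lebesgue_measure]_x (h x * p.[x])%:E = 0)%E ->
  forall a r : R, 0 < r -> (\int[lebesgue_measure]_(x in ball a r) (h x)%:E = 0)%E.
Proof.
move=> eps0 mh ih h0 a r r0.
have ln2 : 0 < ln 2 :> R by rewrite ln_gt0// ltr1n.
(* With delta = ln 2 / (N r^2) the N-th power of exp(-delta (x - a)^2) is
   2^(-((x - a) / r)^2), which crosses 1/2 exactly where |x - a| = r; a
   large N makes 4 delta <= eps. *)
pose N := (Num.truncn (4 * ln 2 / (eps * r ^+ 2))).+1.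
have er0 : 0 < eps * r ^+ 2 by rewrite mulr_gt0// exprn_gt0.
have HN : 4 * ln 2 / (eps * r ^+ 2) < N%:R by exact: truncnS_gt.
have N0 : 0 < N%:R :> R by rewrite ltr0n.
pose delta : R := ln 2 / (N%:R * r ^+ 2).
have Nr0 : 0 < N%:R * r ^+ 2 by rewrite mulr_gt0// exprn_gt0.
have delta0 : 0 <= delta by rewrite divr_ge0// ltW.
have deps : 4 * delta <= eps.
  by rewrite /delta mulrA ler_pdivrMr// mulrCA ltW// -ltr_pdivrMr.
set w := fun x => expR (- (delta * (x - a) ^+ 2)).
have w0 x : 0 <= w x by exact: expR_ge0.
have w1 x : w x <= 1 by rewrite expR_le1 oppr_le0 mulr_ge0// sqr_ge0.
have mw : measurable_fun setT w.
  apply: measurableT_comp => //; apply: measurableT_comp => //.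
  apply: measurable_funM => //; apply: measurable_funX.
  exact: measurable_funB.
have normh : lebesgue_measure.-integrable setT (EFin \o (fun x => `|h x|)).
  apply: le_integrable ih => //; first by apply/measurable_EFinP; exact: measurableT_comp.
  move=> x _ /=; rewrite lee_fin normrM ler_peMr// ger0_norm ?expR_ge0//.
  by rewrite (le_trans _ (expR_ge1Dx _))// lerDl mulr_ge0 ?sqr_ge0 ?ltW.
have ihw n : lebesgue_measure.-integrable setT (EFin \o (fun x => h x * w x ^+ n)).
  apply: le_integrable normh => //.
    apply/measurable_EFinP; apply: measurable_funM => //.
    exact: measurable_funX.
  move=> x _ /=; rewrite lee_fin normrM normr_id ler_piMr//.
  by rewrite ger0_norm ?exprn_ge0// exprn_ile1.
have hw0 n : (\int[lebesgue_measure]_x (h x * w x ^+ n)%:E = 0)%E.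
  rewrite -[RHS](vanishing_moments_gauss _ _ _ _ a delta0 deps eps0 mh ih h0 n 1).
  by apply: eq_integral => x _; rewrite hornerC mulr1.
pose P n : {poly R} := 1 - (1 - 'X^(N * n)) ^+ (2 ^ n).
have PE n x : (P n).[w x] = 1 - (1 - (w x ^+ N) ^+ n) ^+ (2 ^ n).
  by rewrite !(hornerE, horner_exp, hornerXn) exprM.
have wNE x : w x ^+ N = expR (- (ln 2 * ((x - a) / r) ^+ 2)).
  rewrite -expRM_natl; congr expR; rewrite /delta; field.
  by rewrite !gt_eqF.
have v0 x : 0 <= w x ^+ N by rewrite exprn_ge0.
have v1 x : w x ^+ N <= 1 by rewrite exprn_ile1.
have half : 2^-1 = expR (- ln 2) :> R by rewrite expRN lnK ?posrE.
rewrite integral_mkcond.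
rewrite (_ : (fun x => (h x)%:E) \_ (ball a r) = EFin \o (h \_ (ball a r))); last first.
  by rewrite restrict_EFin.
apply: (@dominated_vanishing _ (fun n x => h x * (P n).[w x]) _ (fun x => `|h x|)) => //.
- move=> n; apply: measurable_funM => //; apply: measurableT_comp => //.
  exact: measurable_horner.
- by apply/(measurable_restrictT _ _).1 => //; [exact: measurable_ball | exact: measurable_funTS].
- have rN0 : 0 < r^-1 by rewrite invr_gt0.
  exists [set a - r; a + r]; split.
    by apply: measurableU; exact: measurable_set1.
    apply: countable_lebesgue_measure0; exact: finite_set_countable.
  move=> x /=; apply: contra_notP => /not_orP[xr1 xr2].
  rewrite patchE; have [xr|xr] := ltP `|a - x| r.
    rewrite mem_set//.
    have vx : 2^-1 < w x ^+ N.
      rewrite wNE half ltr_expR ltrN2 gtr_pMr// -real_normK ?num_real// exprn_ilt1//.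
      by rewrite normrM (gtr0_norm rN0) distrC ltr_pdivrMr// mul1r.
    have := cvgM_onem _ (h x) _ _ (threshold_cvg0 _ _ (v1 x) vx).
    by rewrite subr0 mulr1; under [X in _ -> X]eq_cvg do rewrite PE.
  rewrite memNset; last by rewrite /ball/=; apply/negP; rewrite -leNgt.
  have xr' : 1 < `|(x - a) / r|.
    rewrite normrM (gtr0_norm rN0) distrC ltr_pdivlMr// mul1r lt_neqAle xr andbT.
    apply/eqP => rE; have [ax|ax] := leP a x.
      by apply: xr2; rewrite rE distrC ger0_norm; lra.
    by apply: xr1; rewrite rE gtr0_norm; lra.
  have vx : w x ^+ N < 2^-1.
    by rewrite wNE half ltr_expR ltrN2 ltr_pMr// -real_normK ?num_real// exprn_egt1.
  have := cvgM_onem _ (h x) _ _ (threshold_cvg1 _ _ (v0 x) vx).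
  by rewrite subrr mulr0; under [X in _ -> X]eq_cvg do rewrite PE.
- move=> n x; rewrite normrM ler_piMr// PE.
  have u0 : 0 <= 1 - (w x ^+ N) ^+ n by rewrite subr_ge0 exprn_ile1.
  have u1 : 1 - (w x ^+ N) ^+ n <= 1 by rewrite lerBlDr lerDl exprn_ge0.
  have := exprn_ge0 (2 ^ n) u0; have := exprn_ile1 (2 ^ n) u0 u1.
  by move=> ? ?; rewrite ger0_norm; lra.
- move=> n; exact: integral_comp_horner0.
Qed.

(** A function with a Gaussian margin is determined by its moments: its
    integrals over all balls vanish, so it vanishes at its Lebesgue points. *)
Lemma vanishing_moments_ae0 (R : realType) (h : R -> R) (eps : R) :
  0 < eps -> measurable_fun setT h ->
  lebesgue_measure.-integrable setT (EFin \o (fun x => `|h x| * expR (eps * x ^+ 2))) ->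
  (forall p : {poly R}, \int[lebesgue_measure]_x (h x * p.[x])%:E = 0)%E ->
  {ae lebesgue_measure, forall x, h x = 0}.
Proof.
move=> eps0 mh ih h0.
have inth : lebesgue_measure.-integrable setT (EFin \o h).
  apply: le_integrable ih => //; first by apply/measurable_EFinP.
  move=> x _ /=; rewrite lee_fin normrM normr_id ler_peMr// ger0_norm ?expR_ge0//.
  by rewrite (le_trans _ (expR_ge1Dx _))// lerDl mulr_ge0 ?sqr_ge0 ?ltW.
have := lebesgue_differentiation (open_integrable_locally openT inth).
apply: (@filterS _ _ (@ae_filter_ringOfSetsType _ _ _ lebesgue_measure)) => x hx.
(* As the integral of h over the ball vanishes, |h x| is at most the mean
   of |h y - h x| over the ball, which tends to 0. *)
suff : (`|h x|%:E <= 0)%E by rewrite lee_fin normr_le0 => /eqP.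
apply: (cvge_to_ge hx); near=> r.
have r0 : 0 < r by near: r; exact: nbhs_right_gt.
rewrite /davg /iavg (lebesgue_measure_ball _ (ltW r0)) inver gt_eqF ?mulrn_wgt0//.
have r2 : 0 < r *+ 2 by rewrite mulrn_wgt0.
rewrite lee_pdivlMl//.
have mball : measurable (ball x r : set R) by exact: measurable_ball.
have ihb : lebesgue_measure.-integrable (ball x r) (EFin \o h).
  exact: integrableS inth.
have icst : lebesgue_measure.-integrable (ball x r) (EFin \o cst (h x)).
  apply/integrableP; split; first exact/measurable_EFinP/measurable_cst.
  rewrite /= integral_cst//= (lebesgue_measure_ball _ (ltW r0)) -EFinM ltry//.
rewrite (_ : (_ * _)%E = `|\int[lebesgue_measure]_(y in ball x r) (h y - h x)%:E|%E).
  apply: le_abse_integral => //; apply/measurable_EFinP/measurable_funB => //.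
  exact: measurable_funTS.
rewrite integralB_EFin// (vanishing_moments_ball _ _ _ eps0)// integral_cst//=.
rewrite (lebesgue_measure_ball _ (ltW r0)).
by rewrite sub0e abseN -EFinM /= normrM (gtr0_norm r2) mulrC.
Unshelve. all: by end_near. Qed.

(** * Differentiation of Gaussian integrals *)

Lemma is_derive_under_integral (R : realType) (f df : R -> R -> R) (g : R -> R)
    (a u v : R) :
  a \in `]u, v[ ->
  (forall x, x \in `]u, v[ -> lebesgue_measure.-integrable setT (EFin \o f x)) ->
  (forall x y, x \in `]u, v[ -> is_derive x 1 (f ^~ y) (df x y)) ->
  lebesgue_measure.-integrable setT (EFin \o g) ->
  (forall x y, x \in `]u, v[ -> `|df x y| <= g y) ->
  is_derive a 1 (fun x => \int[lebesgue_measure]_y f x y)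
    (\int[lebesgue_measure]_y df a y).
Proof.
move=> auv intf derf intg le_g.
have g0 y : 0 <= g y by rewrite (le_trans _ (le_g a y auv)).
have d1E x y : x \in `]u, v[ -> partial1of2 f x y = df x y.
  by move=> xuv; rewrite partial1of2E; apply: derive_val; exact: derf.
have d1 : forall x y, `]u, v[%classic x -> setT y -> derivable (f ^~ y) x 1.
  by move=> x y xuv _; apply: ex_derive; exact: derf.
have ub x y : `]u, v[%classic x -> setT y -> `|partial1of2 f x y| <= g y.
  by move=> xuv _; rewrite d1E//; exact: le_g.
have -> : \int[lebesgue_measure]_y df a y =
    \int[lebesgue_measure]_y partial1of2 f a y.
  by apply: eq_Rintegral => y _; rewrite d1E.
apply: DeriveDef.
- exact: (derivable_under_integral measurableT auv intf d1 g0 intg ub).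
- by rewrite -derive1E (differentiation_under_integral measurableT auv intf d1 g0 intg ub).
Qed.

Lemma ler_MVT (R : realType) (f df : R -> R) (a b M : R) : a <= b ->
  (forall x, x \in `[a, b] -> is_derive x 1 f (df x)) ->
  (forall x, x \in `[a, b] -> `|df x| <= M) ->
  `|f b - f a| <= M * `|b - a|.
Proof.
move=> ab derf le_M.
have cf : {within `[a, b], continuous f}.
  apply: derivable_within_continuous => x xab.
  by apply: ex_derive; exact: derf.
have derf' x : x \in `]a, b[ -> is_derive x 1 f (df x).
  by move=> xab; apply: derf; exact: subset_itv_oo_cc.
have [c cab ->] := MVT_segment ab derf' cf.
by rewrite normrM ler_wpM2r// le_M.
Qed.
(** Up to a power of y and a constant, the density of the normal law of mean x
    and standard deviation y, times a power of u - x. *)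
Definition gauss_kernel {R : realType} (j : nat) (x y u : R) : R :=
  (u - x) ^+ j * expR (- ((u - x) ^+ 2 / (2 * y ^+ 2))).
Lemma is_derive_gauss_kernel_mean (R : realType) j (x y u : R) : y != 0 ->
  is_derive x 1 (fun x => gauss_kernel j x y u)
    (y ^- 2 * gauss_kernel j.+1 x y u - j%:R * gauss_kernel j.-1 x y u).
Proof.
move=> y0; rewrite /gauss_kernel.
have d2 : is_derive x 1 (fun x => - ((u - x) ^+ 2 / (2 * y ^+ 2))) ((u - x) / y ^+ 2).
  apply: is_derive_eq; rewrite /GRing.scale /=. 
  by field.
have d3 := is_derive1_comp (is_derive_expR _) d2.
have d1 : is_derive x 1 (fun x => (u - x) ^+ j) (- (j%:R * (u - x) ^+ j.-1)).
  have := is_deriveX j (is_deriveB (is_derive_cst u x 1) (is_derive_id x 1)).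
  rewrite exprfctE; move/is_derive_eq; apply.
  by rewrite /GRing.scale /= sub0r mulrN1.
have := is_deriveM d1 d3.
move/is_derive_eq; apply; rewrite /GRing.scale /= (exprS _ j).
by field.
Qed.

Lemma is_derive_gauss_kernel_sd (R : realType) j (x y u : R) : y != 0 ->
  is_derive y 1 (fun y => gauss_kernel j x y u)
    (y ^- 3 * gauss_kernel j.+2 x y u).
Proof.
move=> y0; rewrite /gauss_kernel.
have d0 : is_derive y 1 (fun y => 2 * y ^+ 2) (4 * y).
  apply: is_derive_eq; rewrite /GRing.scale /=; by ring.
have y20 : 2 * y ^+ 2 != 0 by rewrite mulf_neq0 ?expf_neq0.
have d4 := @is_deriveV _ (fun y => 2 * y ^+ 2) _ _ _ y20 d0.
have d2 : is_derive y 1 (fun y => - ((u - x) ^+ 2 / (2 * y ^+ 2))) ((u - x) ^+2 / y ^+ 3).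
  have := is_deriveN (is_deriveM (is_derive_cst ((u - x) ^+ 2) y 1) d4).
  move/is_derive_eq; apply; rewrite /GRing.scale /=.
  by field.
have d3 := is_derive1_comp (is_derive_expR _) d2.
have := is_deriveM (is_derive_cst ((u - x) ^+ j) y 1) d3.
move/is_derive_eq; apply; rewrite /GRing.scale /= (exprS _ j.+1) (exprS _ j).
by field.
Qed.

(** For y < Y the exponential is at most exp(-(u - x)^2 / (2 Y^2)); the gap
    between 1 / (2 Y^2) and c absorbs the power of u - x and the shift by x. *)
Lemma gauss_kernel_dominated (R : realType) (j : nat) (A c Y : R) :
  0 < c -> 0 < Y -> c < (2 * Y ^+ 2)^-1 ->
  exists2 D : R, 0 < D & forall x y u, `|x| <= A -> 0 < y -> y < Y ->
    `|gauss_kernel j x y u| <= D * expR (- (c * u ^+ 2)).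
Proof.
move=> c0 Y0 cY; set b := (2 * Y ^+ 2)^-1 in cY.
(* The part b - m of the exponent absorbs the power, the part m - c the shift. *)
pose m := (b + c) / 2.
have [D1 D10 HD1] := poly_le_expR_sqr _ 'X^j (b - m) ltac:(rewrite /m; lra).
have mc : 0 < m - c by rewrite /m; lra.
have m0 : 0 < m by lra.
pose K := m ^+ 2 * A ^+ 2 / (m - c).
exists ((D1 + 1) * expR K); first by rewrite mulr_gt0 ?expR_gt0//; lra.
move=> x y u xA y0 yY.
have y2 : 0 < y ^+ 2 by rewrite exprn_gt0.
have by2 : b <= (2 * y ^+ 2)^-1.
  rewrite /b lef_pV2 ?posrE; [|by nra|by nra].
  by rewrite ler_pM2l// ler_sqr ?nnegrE; lra.
rewrite /gauss_kernel normrM (ger0_norm (expR_ge0 _)).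
have /= := HD1 (u - x); rewrite hornerXn => Hj.
have e1 : expR (- ((u - x) ^+ 2 / (2 * y ^+ 2))) <= expR (- (b * (u - x) ^+ 2)).
  by rewrite ler_expR lerN2 mulrC ler_wpM2l// sqr_ge0.
apply: (@le_trans _ _ (D1 * expR ((b - m) * (u - x) ^+ 2) * expR (- (b * (u - x) ^+ 2)))).
  by rewrite ler_pM// expR_ge0.
rewrite -mulrA -expRD -mulrA -expRD ler_pM ?expR_ge0//; first by lra.
rewrite ler_expR.
have : m ^+ 2 * x ^+ 2 / (m - c) <= K.
  rewrite /K ler_pM2r ?invr_gt0// ler_pM2l ?exprn_gt0//.
  by rewrite -(real_normK (num_real x)) ler_sqr ?nnegrE// (le_trans _ xA).
have -> : m ^+ 2 * x ^+ 2 / (m - c) =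
   ((m - c) * u - m * x) ^+ 2 / (m - c) - (m - c) * u ^+ 2 + 2 * m * u * x.
  by field; rewrite gt_eqF.
have : 0 <= ((m - c) * u - m * x) ^+ 2 / (m - c) by rewrite divr_ge0 ?sqr_ge0// ltW.
have : 0 <= m * x ^+ 2 by rewrite mulr_ge0 ?sqr_ge0 ?ltW.
nra.
Qed.

Lemma measurable_gauss_kernel (R : realType) j (x y : R) :
  measurable_fun setT (gauss_kernel j x y).
Proof.
rewrite /gauss_kernel; apply: measurable_funM.
  by apply: measurable_funX; exact: measurable_funB.
apply: measurableT_comp => //; apply: measurableT_comp => //.
apply: measurable_funM => //; apply: measurable_funX.
exact: measurable_funB.
Qed.

Definition gauss_moment {R : realType} (G : R -> R) (j : nat) (x y : R) : R :=
  \int[lebesgue_measure]_u (G u * gauss_kernel j x y u).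

Section gauss_moment_regularity.
Context {R : realType} (G : R -> R) (c Y : R).
Hypotheses (c0 : 0 < c) (Y0 : 0 < Y) (cY : c < (2 * Y ^+ 2)^-1).
Hypothesis mG : measurable_fun setT G.
Hypothesis iG : lebesgue_measure.-integrable setT
  (EFin \o (fun u => `|G u| * expR (- (c * u ^+ 2)))).

Let integrableZ (D : R) : lebesgue_measure.-integrable setT
  (EFin \o (fun u => D * (`|G u| * expR (- (c * u ^+ 2))))).
Proof.
rewrite (_ : EFin \o _ =
    (fun u => D%:E * (`|G u| * expR (- (c * u ^+ 2)))%:E)%E).
  exact: integrableZl.
by apply/funext => u /=; rewrite EFinM.
Qed.

Lemma integrable_gauss_moment j (x y : R) : 0 < y -> y < Y ->
  lebesgue_measure.-integrable setT (EFin \o (fun u => G u * gauss_kernel j x y u)).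
Proof.
move=> y0 yY; have [D D0 HD] := gauss_kernel_dominated R j `|x| c Y c0 Y0 cY.
apply: le_integrable (integrableZ D) => //.
  apply/measurable_EFinP; apply: measurable_funM => //.
  exact: measurable_gauss_kernel.
move=> u _ /=; rewrite lee_fin normrM [leRHS]ger0_norm; last first.
  by rewrite mulr_ge0 ?(ltW D0)// mulr_ge0// expR_ge0.
by rewrite mulrCA ler_wpM2l// HD.
Qed.

(** Being uniform in y down to 0, this bound serves for the functions below and,
    through the formulas for their derivatives, for their Lipschitz constants. *)
Lemma gauss_moment_bounded j A : exists2 B : R, 0 < B &
  forall x y, `|x| <= A -> 0 < y -> y < Y -> `|gauss_moment G j x y| <= B.
Proof.
have [D D0 HD] := gauss_kernel_dominated R j A c Y c0 Y0 cY.
exists (\int[lebesgue_measure]_u (D * (`|G u| * expR (- (c * u ^+ 2)))) + 1).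
  rewrite ltr_wpDl// Rintegral_ge0// => u _.
  by rewrite mulr_ge0 ?(ltW D0)// mulr_ge0// expR_ge0.
move=> x y xA y0 yY; rewrite (@le_trans _ _
  (\int[lebesgue_measure]_u (D * (`|G u| * expR (- (c * u ^+ 2))))))//; last by rewrite lerDl.
have im := integrable_gauss_moment j x y y0 yY.
rewrite /gauss_moment (le_trans (le_normr_Rintegral measurableT im))//.
apply: le_Rintegral => //.
  exact: integrable_norm.
by move=> u _; rewrite normrM [leRHS]mulrCA ler_wpM2l// HD.
Qed.

Let is_derive_mull (f : R -> R) (x d a : R) :
  is_derive x 1 f d -> is_derive x 1 (fun x => a * f x) (a * d).
Proof.
move=> df; have := is_deriveM (is_derive_cst a x 1) df.
by move/is_derive_eq; apply; rewrite /GRing.scale /= mulr0 addr0.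
Qed.

Lemma is_derive_gauss_moment_mean j (x y : R) : 0 < y -> y < Y ->
  is_derive x 1 (fun x => gauss_moment G j x y)
    (y ^- 2 * gauss_moment G j.+1 x y - j%:R * gauss_moment G j.-1 x y).
Proof.
move=> y0 yY; have yn0 : y != 0 by rewrite gt_eqF.
have xI : x \in `]x - 1, x + 1[ by rewrite in_itv/=; apply/andP; split; lra.
have le_x z : z \in `]x - 1, x + 1[ -> `|z| <= `|x| + 1.
  rewrite in_itv/= => /andP[z1 z2]; rewrite ler_norml.
  by have := ler_norm x; have := lerNnormlW (lexx `|x|); move=> ? ?; apply/andP; split; lra.
have [D1 D10 HD1] := gauss_kernel_dominated R j.+1 (`|x| + 1) c Y c0 Y0 cY.
have [D2 D20 HD2] := gauss_kernel_dominated R j.-1 (`|x| + 1) c Y c0 Y0 cY.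
have int1 := integrable_gauss_moment j.+1 x y y0 yY.
have int2 := integrable_gauss_moment j.-1 x y y0 yY.
have y2 : 0 <= y ^- 2 by rewrite invr_ge0 exprn_ge0// ltW.
have := is_derive_under_integral R (fun x u => G u * gauss_kernel j x y u)
  (fun x u => G u * (y ^- 2 * gauss_kernel j.+1 x y u - j%:R * gauss_kernel j.-1 x y u))
  (fun u => (y ^- 2 * D1 + j%:R * D2) * (`|G u| * expR (- (c * u ^+ 2))))
  x (x - 1) (x + 1) xI.
move=> H; apply: is_derive_eq; first apply: H.
- by move=> z _; exact: integrable_gauss_moment.
- by move=> z u _; apply: is_derive_mull; exact: is_derive_gauss_kernel_mean.
- exact: integrableZ.
- move=> z u /le_x zA; rewrite normrM [leRHS]mulrCA ler_wpM2l// mulrDl.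
  rewrite (le_trans (ler_normB _ _))// lerD//.
    by rewrite normrM (ger0_norm y2) -mulrA ler_wpM2l// HD1.
  by rewrite normrM (ger0_norm (ler0n _ _)) -mulrA ler_wpM2l// HD2.
- rewrite /gauss_moment -!RintegralZl// -RintegralB//.
  + by apply: eq_Rintegral => u _; rewrite mulrBr !(mulrCA (G u)).
  + by have := integrableZl measurableT (y ^- 2) int1.
  + by have := integrableZl measurableT j%:R int2.
Qed.

Lemma is_derive_gauss_moment_sd j (x y : R) : 0 < y -> y < Y ->
  is_derive y 1 (fun y => gauss_moment G j x y)
    (y ^- 3 * gauss_moment G j.+2 x y).
Proof.
move=> y0 yY.
have yI : y \in `]y / 2, Y[ by rewrite in_itv/=; apply/andP; split; lra.
have le_y z : z \in `]y / 2, Y[ -> [/\ 0 < z, z < Y & 0 <= z ^- 3 <= (y / 2) ^- 3].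
  rewrite in_itv/= => /andP[z1 z2]; have z0 : 0 < z by lra.
  split=> //; rewrite invr_ge0 exprn_ge0 ?(ltW z0)//= lef_pV2 ?posrE ?exprn_gt0//; last by lra.
  by rewrite lerXn2r ?nnegrE; lra.
have [D1 D10 HD1] := gauss_kernel_dominated R j.+2 `|x| c Y c0 Y0 cY.
have int1 := integrable_gauss_moment j.+2 x y y0 yY.
have := is_derive_under_integral R (fun y u => G u * gauss_kernel j x y u)
  (fun y u => G u * (y ^- 3 * gauss_kernel j.+2 x y u))
  (fun u => ((y / 2) ^- 3 * D1) * (`|G u| * expR (- (c * u ^+ 2))))
  y (y / 2) Y yI.
move=> H; apply: is_derive_eq; first apply: H.
- by move=> z /le_y[z0 zY _]; exact: integrable_gauss_moment.
- move=> z u /le_y[z0 _ _]; apply: is_derive_mull.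
  by apply: is_derive_gauss_kernel_sd; rewrite gt_eqF.
- exact: integrableZ.
- move=> z u /le_y[z0 zY /andP[z30 z3]].
  rewrite normrM [leRHS]mulrCA ler_wpM2l// normrM (ger0_norm z30) -mulrA ler_pM//.
  exact: HD1.
- rewrite /gauss_moment -!RintegralZl//.
  by apply: eq_Rintegral => u _; rewrite (mulrCA (G u)).
Qed.

End gauss_moment_regularity.

(** * Gaussian moments of the derivative *)

(** Integration by parts shows that this is y^2 times the k-th moment
    [gauss_moment] of the derivative of G, when G has one. *)
Definition gradient_moment {R : realType} (G : R -> R) (k : nat) (x y : R) : R :=
  gauss_moment G k.+1 x y - k%:R * y ^+ 2 * gauss_moment G k.-1 x y.

Section gradient_moment_regularity.
Context {R : realType} (G : R -> R) (c Y : R).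
Hypotheses (c0 : 0 < c) (Y0 : 0 < Y) (cY : c < (2 * Y ^+ 2)^-1).
Hypothesis mG : measurable_fun setT G.
Hypothesis iG : lebesgue_measure.-integrable setT
  (EFin \o (fun u => `|G u| * expR (- (c * u ^+ 2)))).

(** The same recursion as for [gauss_moment], as if it were applied to the
    derivative of G.  It closes up on the family of the gradient moments, which
    is what makes the order of vanishing in x computable. *)
Lemma is_derive_gradient_moment_mean k (x y : R) : 0 < y -> y < Y ->
  is_derive x 1 (fun x => gradient_moment G k x y)
    (y ^- 2 * gradient_moment G k.+1 x y - k%:R * gradient_moment G k.-1 x y).
Proof.
move=> y0 yY; have yn0 : y != 0 by rewrite gt_eqF.
have d1 := is_derive_gauss_moment_mean G c Y c0 Y0 cY mG iG k.+1 x y y0 yY.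
have d2 := is_derive_gauss_moment_mean G c Y c0 Y0 cY mG iG k.-1 x y y0 yY.
have := is_deriveB d1 (is_deriveM (is_derive_cst (k%:R * y ^+ 2) x 1) d2).
move/is_derive_eq; apply; rewrite /GRing.scale /= /gradient_moment.
case: k {d1 d2} => [|[|k]] /=; first by field.
  by field.
by rewrite -!natr1; field.
Qed.

Lemma is_derive_gradient_moment_sd k (x y : R) : 0 < y -> y < Y ->
  is_derive y 1 (fun y => gradient_moment G k x y)
    (y ^- 3 * gauss_moment G k.+3 x y - k%:R * (2 * y * gauss_moment G k.-1 x y
      + y ^-1 * gauss_moment G k.-1.+2 x y)).
Proof.
move=> y0 yY; have yn0 : y != 0 by rewrite gt_eqF.
have d1 := is_derive_gauss_moment_sd G c Y c0 Y0 cY mG iG k.+1 x y y0 yY.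
have d2 := is_derive_gauss_moment_sd G c Y c0 Y0 cY mG iG k.-1 x y y0 yY.
have d3 : is_derive y 1 (fun y => k%:R * y ^+ 2) (k%:R * (2 * y)).
  by apply: is_derive_eq; rewrite /GRing.scale /=; ring.
have := is_deriveB d1 (is_deriveM d3 d2).
move/is_derive_eq; apply; rewrite /GRing.scale /=.
by field.
Qed.

Lemma gradient_moment_bounded k A : exists2 B : R, 0 < B &
  forall x y, `|x| <= A -> 0 < y -> y < Y -> `|gradient_moment G k x y| <= B.
Proof.
have [B1 B10 HB1] := gauss_moment_bounded G c Y c0 Y0 cY mG iG k.+1 A.
have [B2 B20 HB2] := gauss_moment_bounded G c Y c0 Y0 cY mG iG k.-1 A.
have ? : 0 <= k%:R * Y ^+ 2 by rewrite mulr_ge0// exprn_ge0// ltW.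
exists (B1 + k%:R * Y ^+ 2 * B2) => [|x y xA y0 yY]; first by rewrite ltr_wpDr// mulr_ge0// ltW.
rewrite (le_trans (ler_normB _ _))// lerD ?HB1// normrM ler_pM ?HB2//.
rewrite ger0_norm; last by rewrite mulr_ge0// exprn_ge0// ltW.
by rewrite ler_wpM2l// lerXn2r ?nnegrE ?ltW.
Qed.

Lemma gradient_moment_lipschitz k A a : 0 < a -> exists2 L : R, 0 < L &
  forall x x' y y', `|x| <= A -> `|x'| <= A -> a <= y -> y < Y -> a <= y' -> y' < Y ->
   `|gradient_moment G k x y - gradient_moment G k x' y'| <= L * (`|x - x'| + `|y - y'|).
Proof.
move=> a0.
have [C1 C10 HC1] := gradient_moment_bounded k.+1 A.
have [C2 C20 HC2] := gradient_moment_bounded k.-1 A.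
have [B1 B10 HB1] := gauss_moment_bounded G c Y c0 Y0 cY mG iG k.+3 A.
have [B2 B20 HB2] := gauss_moment_bounded G c Y c0 Y0 cY mG iG k.-1 A.
have [B3 B30 HB3] := gauss_moment_bounded G c Y c0 Y0 cY mG iG k.-1.+2 A.
pose L1 := a ^- 2 * C1 + k%:R * C2.
pose L2 := a ^- 3 * B1 + k%:R * (2 * Y * B2 + a^-1 * B3).
have k0 : 0 <= k%:R :> R by [].
have i0 : 0 < a^-1 by rewrite invr_gt0.
have i2 n : 0 < a ^- n by rewrite invr_gt0 exprn_gt0.
have L10 : 0 < L1 by rewrite ltr_wpDr ?mulr_gt0// mulr_ge0// ltW.
have L20 : 0 < L2.
  rewrite ltr_wpDr ?mulr_gt0// mulr_ge0// addr_ge0//; first by rewrite !mulr_ge0// ltW.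
  by rewrite mulr_ge0// ltW.
have le_inv n y : a <= y -> 0 <= y ^- n <= a ^- n.
  move=> ay; rewrite invr_ge0 exprn_ge0 ?(le_trans (ltW a0) ay)//=.
  rewrite lef_pV2 ?posrE ?exprn_gt0// ?(lt_le_trans a0 ay)//.
  by rewrite lerXn2r ?nnegrE ?(ltW a0)// (le_trans (ltW a0) ay).
have lip_x x x' y : x <= x' -> `|x| <= A -> `|x'| <= A -> a <= y -> y < Y ->
    `|gradient_moment G k x' y - gradient_moment G k x y| <= L1 * `|x' - x|.
  move=> xx' xA x'A ay yY; have y0 := lt_le_trans a0 ay.
  apply: (ler_MVT R (fun x => gradient_moment G k x y)
    (fun x => y ^- 2 * gradient_moment G k.+1 x y - k%:R * gradient_moment G k.-1 x y)) => //.
    by move=> z _; exact: is_derive_gradient_moment_mean.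
  move=> z /[!in_itv]/= /andP[xz zx'].
  have zA : `|z| <= A.
    move: xA x'A; rewrite !ler_norml => /andP[? ?] /andP[? ?].
    by apply/andP; split; lra.
  have /andP[y20 y2a] := le_inv 2 y ay.
  rewrite (le_trans (ler_normB _ _))// lerD// normrM (ger0_norm _)// ler_pM//.
    exact: HC1.
  exact: HC2.
have lip_y x y y' : y <= y' -> `|x| <= A -> a <= y -> y' < Y ->
    `|gradient_moment G k x y' - gradient_moment G k x y| <= L2 * `|y' - y|.
  move=> yy' xA ay yY; have y0 := lt_le_trans a0 ay.
  apply: (ler_MVT R (fun y => gradient_moment G k x y)
    (fun y => y ^- 3 * gauss_moment G k.+3 x y - k%:R * (2 * y * gauss_moment G k.-1 x y
      + y ^-1 * gauss_moment G k.-1.+2 x y))) => //.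
    move=> z /[!in_itv]/= /andP[yz zy'].
    by apply: is_derive_gradient_moment_sd; lra.
  move=> z /[!in_itv]/= /andP[yz zy'].
  have z0 : 0 < z by lra.
  have zY : z < Y by lra.
  have az : a <= z by lra.
  have /andP[z30 z3a] := le_inv 3 z az.
  have /andP[z10 z1a] := le_inv 1%N z az.
  rewrite (le_trans (ler_normB _ _))// lerD//.
    by rewrite normrM (ger0_norm z30) ler_pM// HB1.
  rewrite normrM (ger0_norm k0) ler_wpM2l// (le_trans (ler_normD _ _))// lerD//.
    rewrite normrM ler_pM// ?HB2// ger0_norm; last by rewrite mulr_ge0// ltW.
    by rewrite ler_wpM2l// ltW.
  by rewrite normrM ger0_norm// ler_pM// HB3.
exists (L1 + L2) => [|x x' y y' xA x'A ay yY ay' y'Y]; first exact: addr_gt0.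
have hx : `|gradient_moment G k x y - gradient_moment G k x' y| <= L1 * `|x - x'|.
  have [/ltW xx'|xx'] := ltP x x'; last exact: lip_x.
  by rewrite distrC (distrC x); exact: lip_x.
have hy : `|gradient_moment G k x' y - gradient_moment G k x' y'| <= L2 * `|y - y'|.
  have [/ltW yy'|yy'] := ltP y y'; last exact: lip_y.
  by rewrite distrC (distrC y); exact: lip_y.
rewrite -(subrKA (gradient_moment G k x' y)) (le_trans (ler_normD _ _))//.
rewrite mulrDr; apply: lerD.
  by rewrite (le_trans hx)// ler_wpM2r// lerDl ltW.
by rewrite (le_trans hy)// ler_wpM2r// lerDr ltW.
Qed.

End gradient_moment_regularity.

(** A mean value theorem without an order on the end points; the intermediate
    point stays in every interval centred at 0 that contains both of them. *)
Lemma MVT_between (R : realType) (f df : R -> R) (a b : R) :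
  (forall x : R, is_derive x 1 f (df x)) ->
  exists c, [/\ `|c - a| <= `|b - a|,
    forall A, `|a| <= A -> `|b| <= A -> `|c| <= A &
    f b - f a = df c * (b - a)].
Proof.
move=> derf.
have cf u v : {within `[u, v], continuous f}.
  by apply: derivable_within_continuous => x _; apply: ex_derive; exact: derf.
have [ab|/ltW ba] := leP a b.
  have [z /[!in_itv]/= /andP[az zb] E] := MVT_segment ab (fun x _ => derf x) (cf a b).
  exists z; split=> [|A|//]; first by rewrite !ger0_norm; lra.
  by rewrite !ler_norml => /andP[? ?] /andP[? ?]; apply/andP; split; lra.
have [z /[!in_itv]/= /andP[bz za] E] := MVT_segment ba (fun x _ => derf x) (cf b a).
exists z; split=> [|A|]; last by rewrite -opprB E -mulrN opprB.
  by rewrite distrC (distrC b) !ger0_norm; lra.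
by rewrite !ler_norml => /andP[? ?] /andP[? ?]; apply/andP; split; lra.
Qed.

Section gradient_moment_zeros.
Context {R : realType} (G : R -> R) (c Y : R).
Hypotheses (c0 : 0 < c) (Y0 : 0 < Y) (cY : c < (2 * Y ^+ 2)^-1).
Hypothesis mG : measurable_fun setT G.
Hypothesis iG : lebesgue_measure.-integrable setT
  (EFin \o (fun u => `|G u| * expR (- (c * u ^+ 2)))).

(** Where g_k and g_(k-1) vanish but g_(k+1) does not, the derivative of g_k in x
    is y^-2 g_(k+1), and it stays away from 0 nearby.  Comparing
    g_k(x', y) - g_k(x, y) with g_k(x', y) - g_k(x', y'), for two zeros (x, y) and
    (x', y') of g_k, bounds |x - x'| by a multiple of |y - y'|. *)
Lemma gradient_moment_zeros_graph k A a m : 0 < a -> 0 < m ->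
  exists2 r : R, 0 < r & exists K : R, forall x x' y y',
    `|x| <= A -> `|x'| <= A -> a <= y -> y < Y -> a <= y' -> y' < Y ->
    gradient_moment G k x y = 0 -> gradient_moment G k.-1 x y = 0 ->
    m <= `|gradient_moment G k.+1 x y| -> gradient_moment G k x' y' = 0 ->
    `|x - x'| <= r -> `|x - x'| <= K * `|y - y'|.
Proof.
move=> a0 m0.
have [L L0 HL] := gradient_moment_lipschitz G c Y c0 Y0 cY mG iG k A a a0.
have [L1 L10 HL1] := gradient_moment_lipschitz G c Y c0 Y0 cY mG iG k.+1 A a a0.
have [L2 L20 HL2] := gradient_moment_lipschitz G c Y c0 Y0 cY mG iG k.-1 A a a0.
have Y2 : 0 < Y ^- 2 by rewrite invr_gt0 exprn_gt0.
have M0 : 0 < Y ^- 2 * L1 + k%:R * L2 by rewrite ltr_wpDr ?mulr_gt0// mulr_ge0// ltW.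
(* The derivative of g_k in x is at least 2 e at the given zero; r is small
   enough for it to stay above e between x and x'. *)
pose e := Y ^- 2 * m / 2.
have e0 : 0 < e by rewrite divr_gt0// mulr_gt0.
exists (e / (Y ^- 2 * L1 + k%:R * L2)); first exact: divr_gt0.
exists (L / e) => x x' y y' xA x'A ay yY ay' y'Y gk gk1 gm gk' xx'.
have y0 := lt_le_trans a0 ay.
have [z [zx le_zA E]] := MVT_between R (fun x => gradient_moment G k x y)
    (fun x => y ^- 2 * gradient_moment G k.+1 x y - k%:R * gradient_moment G k.-1 x y)
    x x' (fun x => is_derive_gradient_moment_mean G c Y c0 Y0 cY mG iG k x y y0 yY).
have zA := le_zA A xA x'A.
have xz : `|x - z| <= `|x - x'| by rewrite (distrC x z) (distrC x x').
have h1 := HL1 x z y y xA zA ay yY ay yY.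
have h2 := HL2 x z y y xA zA ay yY ay yY.
rewrite subrr normr0 addr0 in h1 h2.
rewrite gk1 sub0r normrN in h2.
have y2 : Y ^- 2 <= y ^- 2.
  rewrite lef_pV2 ?posrE ?exprn_gt0// lerXn2r ?nnegrE ?(ltW y0) ?(ltW Y0)//.
  exact: ltW.
have le_e : e <= `|y ^- 2 * gradient_moment G k.+1 z y - k%:R * gradient_moment G k.-1 z y|.
  have h3 : m - L1 * `|x - x'| <= `|gradient_moment G k.+1 z y|.
    have h4 := ler_distD (gradient_moment G k.+1 z y) (gradient_moment G k.+1 x y) 0.
    rewrite !subr0 in h4.
    rewrite lerBlDl (le_trans gm)// (le_trans h4)// lerD2r.
    by rewrite (le_trans h1)// ler_pM2l.
  have h5 : `|gradient_moment G k.-1 z y| <= L2 * `|x - x'|.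
    by rewrite (le_trans h2)// ler_pM2l.
  rewrite (le_trans _ (lerB_dist _ _))// !normrM (normr_nat _ k).
  rewrite (le_trans (_ : _ <= Y ^- 2 * (m - L1 * `|x - x'|) - k%:R * (L2 * `|x - x'|)))//.
    have -> : Y ^- 2 * (m - L1 * `|x - x'|) - k%:R * (L2 * `|x - x'|) =
        e + (e - `|x - x'| * (Y ^- 2 * L1 + k%:R * L2)).
      by rewrite /e; field; rewrite gt_eqF.
    by rewrite lerDl subr_ge0 -ler_pdivlMr.
  apply: lerB; last by rewrite ler_wpM2l.
  rewrite ger0_norm ?(le_trans (ltW Y2))//.
  rewrite (le_trans (_ : _ <= Y ^- 2 * `|gradient_moment G k.+1 z y|))//.
    by rewrite ler_pM2l.
  by rewrite ler_wpM2r.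
rewrite mulrAC ler_pdivlMr//.
rewrite (le_trans (_ : _ <= `|gradient_moment G k x' y - gradient_moment G k x y|))//.
  by rewrite E normrM (distrC x) mulrC ler_wpM2r.
have := HL x' x' y y' x'A x'A ay yY ay' y'Y.
by rewrite subrr normr0 add0r gk' gk !subr0.
Qed.

End gradient_moment_zeros.

(** * Functions all of whose gradient moments vanish *)

Lemma integrable_expR_Nsqr (R : realType) (c : R) : 0 < c ->
  lebesgue_measure.-integrable setT (EFin \o (fun u : R => expR (- (c * u ^+ 2)))).
Proof.
move=> c0; pose s := Num.sqrt ((2 * c)^-1).
have s0 : s != 0 by rewrite gt_eqF// sqrtr_gt0 invr_gt0; lra.
have ipdf := integrable_normal_pdf 0 s.
apply: le_integrable (integrableZl measurableT (normal_peak s)^-1 ipdf) => //.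
  apply/measurable_EFinP; apply: measurableT_comp => //.
  by apply: measurableT_comp => //; apply: measurable_funM => //; exact: measurable_funX.
move=> u _; rewrite -EFinM (normal_pdfE _ s0) mulKf ?gt_eqF ?normal_peak_gt0//.
rewrite /normal_fun subr0 (_ : - u ^+ 2 / _ = - (c * u ^+ 2))//.
rewrite /s sqr_sqrtr ?invr_ge0; last by lra.
by rewrite -mulr_natr; field; rewrite gt_eqF.
Qed.

(** It is the total mass of an unnormalized normal law. *)
Lemma gauss_moment_cst0_neq0 (R : realType) (x y : R) : 0 < y ->
  gauss_moment (cst 1) 0 x y != 0.
Proof.
move=> y0; have yn0 : y != 0 by rewrite gt_eqF.
apply/eqP => /(congr1 ( *%R (normal_peak y))); rewrite mulr0 => H.
have := integral_normal_pdf x y => H1.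
have : \int[lebesgue_measure]_u normal_pdf x y u = 1 by rewrite /Rintegral H1.
have -> : normal_pdf x y = (fun u => normal_peak y * (cst 1 u * gauss_kernel 0 x y u)).
  apply/funext => u; rewrite (normal_pdfE _ yn0) /normal_fun /gauss_kernel expr0 !mul1r.
  by congr (_ * expR _); rewrite -mulr_natr; field.
rewrite RintegralZl//; first by rewrite -/(gauss_moment _ _ _ _) H => /eqP; rewrite eq_sym oner_eq0.
have ipdf := integrable_normal_pdf x y.
apply: le_integrable (integrableZl measurableT (normal_peak y)^-1 ipdf) => //.
  by apply/measurable_EFinP; apply: measurable_funM => //; exact: measurable_gauss_kernel.
move=> u _; rewrite -EFinM (normal_pdfE _ yn0) mulKf ?gt_eqF ?normal_peak_gt0//.
rewrite /normal_fun /gauss_kernel /= expr0 !mul1r.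
by rewrite (_ : - (u - x) ^+ 2 / _ = - ((u - x) ^+ 2 / (2 * y ^+ 2)))//; field.
Qed.

Section gradient_moment_nonvanishing.
Context {R : realType} (G : R -> R) (c Y : R).
Hypotheses (c0 : 0 < c) (Y0 : 0 < Y) (cY : c < (2 * Y ^+ 2)^-1).
Hypothesis mG : measurable_fun setT G.
Hypothesis iG : lebesgue_measure.-integrable setT
  (EFin \o (fun u => `|G u| * expR (- (c * u ^+ 2)))).

Let i1 : lebesgue_measure.-integrable setT
  (EFin \o (fun u : R => `|cst 1 u| * expR (- (c * u ^+ 2)))).
Proof.
under eq_fun do rewrite normr1 mul1r.
exact: integrable_expR_Nsqr.
Qed.

Let m1 : measurable_fun setT (cst 1 : R -> R).
Proof. exact: measurable_cst. Qed.

(** The moments of a constant do not depend on x, by translation invariance, so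
    their derivative in x vanishes.  This is the recursion between the moments of
    a normal law. *)
Lemma gradient_moment_cst k (x y : R) : 0 < y -> y < Y ->
  gradient_moment (cst 1) k x y = 0.
Proof.
move=> y0 yY; have y2 : y ^+ 2 != 0 by rewrite expf_neq0// gt_eqF.
have gc z : gauss_moment (cst 1) k z y = gauss_moment (cst 1) k 0 y.
  rewrite /gauss_moment.
  have := Rintegral_affine R (- z) 1 _ ltr01 
    (integrable_gauss_moment (cst 1) c Y c0 Y0 cY m1 i1 k 0 y y0 yY).
  rewrite invr1 mul1r => <-; apply: eq_Rintegral => u _.
  by rewrite /gauss_kernel !mul1r subr0 (addrC (- z)).
have d1 := is_derive_gauss_moment_mean (cst 1) c Y c0 Y0 cY m1 i1 k x y y0 yY.
have := is_derive_cst (gauss_moment (cst 1) k 0 y) x 1.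
rewrite (_ : cst _ = (fun x => gauss_moment (cst 1) k x y)); last by apply/funext => z; rewrite gc.
move=> d0; have : y ^- 2 * gauss_moment (cst 1) k.+1 x y - k%:R * gauss_moment (cst 1) k.-1 x y = 0.
  by rewrite -(@derive_val _ _ _ _ _ _ _ d1) (@derive_val _ _ _ _ _ _ _ d0).
move/(congr1 ( *%R (y ^+ 2))); rewrite mulr0 mulrBr mulrA mulfV// mul1r => E.
by rewrite /gradient_moment -E; ring.
Qed.

(** The moments of G - kappa obey the recursion between Gaussian moments, and
    kappa is chosen so that the first one vanishes; hence they all vanish and
    [vanishing_moments_ae0] applies to G - kappa times the Gaussian kernel. *)
Lemma gradient_moment_all0 (x y : R) : 0 < y -> y < Y ->
  (forall k, gradient_moment G k x y = 0) ->
  exists kappa, {ae lebesgue_measure, forall u, G u = kappa}.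
Proof.
move=> y0 yY g0.
pose kappa := gauss_moment G 0 x y / gauss_moment (cst 1) 0 x y.
pose H u := G u - kappa.
have mH : measurable_fun setT H by exact: measurable_funB.
have iGm j := integrable_gauss_moment G c Y c0 Y0 cY mG iG j x y y0 yY.
have i1m j := integrable_gauss_moment (cst 1) c Y c0 Y0 cY m1 i1 j x y y0 yY.
have HE j : gauss_moment H j x y = gauss_moment G j x y - kappa * gauss_moment (cst 1) j x y.
  rewrite /gauss_moment -RintegralZl// -RintegralB//; last first.
    by have := integrableZl measurableT kappa (i1m j).
  by apply: eq_Rintegral => u _; rewrite /H mul1r mulrBl.
have H0 : gauss_moment H 0 x y = 0.
  by rewrite HE /kappa divfK ?subrr// gauss_moment_cst0_neq0.
have Hrec k : gauss_moment H k.+1 x y = k%:R * y ^+ 2 * gauss_moment H k.-1 x y.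
  apply/eqP; rewrite -subr_eq0; apply/eqP.
  transitivity (gradient_moment G k x y - kappa * gradient_moment (cst 1) k x y).
    by rewrite /gradient_moment !HE; ring.
  by rewrite g0 gradient_moment_cst// mulr0 subrr.
have Hall j : gauss_moment H j x y = 0.
  suff : gauss_moment H j x y = 0 /\ gauss_moment H j.+1 x y = 0 by case.
  elim: j => [|j [IH1 IH2]]; first by rewrite Hrec mul0r mul0r.
  by split => //; rewrite Hrec /= IH1 mulr0.
(* The gap between c and b leaves room for c < c' < 1 / (2 Y'^2) < b, so that
   the kernel at (x, y) beats exp(-c' u^2) and c' - c is a Gaussian margin. *)
pose b := (2 * y ^+ 2)^-1.
have cb : c < b.
  rewrite (lt_trans cY)// /b ltf_pV2 ?posrE ?mulr_gt0 ?exprn_gt0//.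
  by rewrite ltr_pM2l// ltrXn2r// ltW.
have [c' cc' c'b] : exists2 c', c < c' & c' < b by exists ((c + b) / 2); lra.
have c'0 : 0 < c' by exact: lt_trans cc'.
pose Y' := Num.sqrt (2 * ((b + c') / 2))^-1.
have Y'0 : 0 < Y' by rewrite sqrtr_gt0 invr_gt0; lra.
have Y'E : (2 * Y' ^+ 2)^-1 = (b + c') / 2.
  rewrite /Y' sqr_sqrtr ?invr_ge0; last by lra.
  by rewrite invfM invrK mulKf.
have yY' : y < Y'.
  rewrite -(ltr_pXn2r (_ : 0 < 2)%N) ?nnegrE ?ltW//.
  have -> : y ^+ 2 = (2 * b)^-1 by rewrite /b; field; rewrite gt_eqF.
  rewrite /Y' sqr_sqrtr ?invr_ge0; last by lra.
  by rewrite ltf_pV2 ?posrE; lra.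
have [D D0 HD] := gauss_kernel_dominated R 0 `|x| c' Y' c'0 Y'0 ltac:(rewrite Y'E; lra).
pose h u := H u * gauss_kernel 0 x y u.
have mh : measurable_fun setT h by apply: measurable_funM => //; exact: measurable_gauss_kernel.
have iH : lebesgue_measure.-integrable setT (EFin \o (fun u => `|H u| * expR (- (c * u ^+ 2)))).
  apply: le_integrable (integrableD measurableT iG (integrableZl measurableT `|kappa| i1)) => //.
    apply/measurable_EFinP; apply: measurable_funM; first exact: measurableT_comp.
    apply: measurableT_comp => //; apply: measurableT_comp => //.
    by apply: measurable_funM => //; exact: measurable_funX.
  move=> u _ /=; rewrite -?EFinM -?EFinD lee_fin normr1 mul1r -mulrDl !normrM !normr_id.
  rewrite ler_wpM2r// ger0_norm ?addr_ge0//.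
  by rewrite -normrM; exact: ler_normB.
have ih : lebesgue_measure.-integrable setT
    (EFin \o (fun u => `|h u| * expR ((c' - c) * u ^+ 2))).
  apply: le_integrable (integrableZl measurableT D iH) => //.
    apply/measurable_EFinP; apply: measurable_funM; first exact: measurableT_comp.
    apply: measurableT_comp => //.
    by apply: measurable_funM => //; exact: measurable_funX.
  move=> u _ /=; have := HD x y u (lexx _) y0 yY'.
  rewrite /h; move: (gauss_kernel 0 x y u) => k le_k.
  rewrite -?EFinM lee_fin !normrM !normr_id.
  rewrite (gtr0_norm D0) !(gtr0_norm (expR_gt0 _)) (mulrCA D) -mulrA ler_wpM2l//.
  rewrite (_ : - (c * u ^+ 2) = - (c' * u ^+ 2) + (c' - c) * u ^+ 2); last by ring.
  by rewrite expRD [leRHS]mulrA ler_wpM2r ?expR_ge0.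
have kE j u : h u * (u - x) ^+ j = H u * gauss_kernel j x y u.
  by rewrite /h /gauss_kernel expr0; ring.
have iHm j : lebesgue_measure.-integrable setT (EFin \o (fun u => h u * (u - x) ^+ j)).
  rewrite (_ : (fun u => _) = (fun u => H u * gauss_kernel j x y u)).
    exact: (integrable_gauss_moment H c Y c0 Y0 cY mH iH).
  by apply/funext => u; rewrite kE.
have h0 (p : {poly R}) : (\int[lebesgue_measure]_u (h u * p.[u])%:E = 0)%E.
  rewrite -[RHS](integral_comp_horner0 R h (fun u => u - x) (p \Po ('X + x%:P)) iHm).
    by apply: eq_integral => u _; rewrite horner_comp !hornerE subrK.
  move=> j; have := Hall j; rewrite /gauss_moment /Rintegral.
  under eq_integral do rewrite -kE.
  move/eqP; rewrite -eqe => /eqP; rewrite fineK//.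
  exact: (integrable_fin_num measurableT (iHm j)).
exists kappa.
have := vanishing_moments_ae0 R h (c' - c) ltac:(lra) mh ih h0.
apply: (@filterS _ _ (@ae_filter_ringOfSetsType _ _ _ lebesgue_measure)) => u /eqP.
rewrite /h /gauss_kernel expr0 mul1r mulf_eq0 expR_eq0 orbF subr_eq0 => /eqP.
exact.
Qed.

End gradient_moment_nonvanishing.

(** * Null sets of Hausdorff measures *)

(** Unfolds the vanishing of the Hausdorff measure into the existence of covers
    of small total weight at every scale, the form in which it is proved. *)
Definition hausdorff_null {R : realType} {T : Type} (dist : T -> T -> R) (s : R)
    (A : set T) : Prop :=
  forall delta eps : R, 0 < delta -> 0 < eps -> exists U : nat -> set T,
    [/\ A `<=` \bigcup_i U i, forall i, (diam dist (U i) <= delta%:E)%E &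
        (\sum_(0 <= i <oo) hausdorff_weight dist s (U i) <= eps%:E)%E].

Lemma hausdorff_weight_ge0 (R : realType) (T : Type) (dist : T -> T -> R) s U :
  (0 <= hausdorff_weight dist s U)%E.
Proof. by rewrite /hausdorff_weight; case: ifP => // _; exact: poweR_ge0. Qed.

Lemma hausdorff_null_measure0 (R : realType) (T : Type) (dist : T -> T -> R) s A :
  hausdorff_null dist s A -> hausdorff_measure dist s A = 0%E.
Proof.
move=> nA; apply/eqP; rewrite eq_le; apply/andP; split.
  apply: ge_ereal_sup => _ [delta /= delta0 <-].
  apply/lee_addgt0Pr => eps eps0; rewrite add0e.
  have [U [AU dU sU]] := nA _ _ delta0 eps0.
  apply: le_trans sU; apply: ereal_inf_lbound.
  by exists U.
apply: le_trans (ereal_sup_ubound (ex_intro2 _ _ 1 _ erefl)) => //=.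
apply: le_ereal_inf_tmp => _ [U _ <-].
by apply: nneseries_ge0 => i _ _; exact: hausdorff_weight_ge0.
Qed.

Lemma hausdorff_null_sub (R : realType) (T : Type) (dist : T -> T -> R) s A B :
  A `<=` B -> hausdorff_null dist s B -> hausdorff_null dist s A.
Proof.
move=> AB nB delta eps delta0 eps0; have [U [BU dU sU]] := nB _ _ delta0 eps0.
by exists U; split => //; exact: subset_trans BU.
Qed.

Lemma nneseries_pair (R : realType) (f : {bij [set: nat] >-> [set: nat * nat]})
    (a : nat * nat -> \bar R) : (forall k, 0 <= a k)%E ->
  (\sum_(0 <= n <oo) a (f n) = \sum_(0 <= i <oo) \sum_(0 <= j <oo) a (i, j))%E.
Proof.
move=> a0; rewrite nneseries_esumT//.
rewrite nneseries_esumT; last by move=> i; apply: nneseries_ge0.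
under [RHS]eq_esum do rewrite nneseries_esumT//.
rewrite (@esum_esum _ _ _ [set: nat] (fun=> [set: nat]) (fun i j => a (i, j)))//.
rewrite -(@reindex_esum _ _ _ setT setT f); last exact: bij.
rewrite (_ : [set: nat] `*`` (fun=> [set: nat]) = setT).
  by apply: eq_esum => -[].
by apply/seteqP; split.
Qed.

Lemma hausdorff_null_bigcup (R : realType) (T : Type) (dist : T -> T -> R) s
    (A : nat -> set T) :
  (forall n, hausdorff_null dist s (A n)) -> hausdorff_null dist s (\bigcup_n A n).
Proof.
move=> nA delta eps delta0 eps0.
have /choice[U UA] : forall n, exists U : nat -> set T,
    [/\ A n `<=` \bigcup_i U i, forall i, (diam dist (U i) <= delta%:E)%E &
        (\sum_(0 <= i <oo) hausdorff_weight dist s (U i) <= (eps / (2 ^ n.+1)%:R)%:E)%E].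
  by move=> n; apply: nA => //; rewrite divr_gt0// ltr0n expn_gt0.
have /card_esym/ppcard_eqP[f] := card_nat2.
exists (fun n => U (f n).1 (f n).2); split => //.
- move=> x [n _ /(let: And3 h _ _ := UA n in h)[i _ Ux]].
  by exists (f^-1%FUN (n, i)) => //; rewrite invK ?inE.
- by move=> i; have [_] := UA (f i).1.
- rewrite (@nneseries_pair _ f (fun k => hausdorff_weight dist s (U k.1 k.2))); last first.
    by move=> k; exact: hausdorff_weight_ge0.
  apply: le_trans (epsilon_trick0 xpredT (ltW eps0)).
  apply: lee_nneseries => [n _ _|n _]; last by have [] := UA n.
  by apply: nneseries_ge0 => i _ _; exact: hausdorff_weight_ge0.
Qed.

Lemma hausdorff_dim_le (R : realType) (T : Type) (dist : T -> T -> R) (t : R) A :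
  0 <= t -> (forall s, t < s -> hausdorff_null dist s A) ->
  (hausdorff_dim dist A <= t%:E)%E.
Proof.
move=> t0 nA; apply/lee_addgt0Pr => eps eps0.
apply: ereal_inf_lbound; exists (t + eps) => //; split.
  by rewrite addr_ge0// ltW.
by apply: hausdorff_null_measure0; apply: nA; rewrite ltrDl.
Qed.

(** * Lipschitz graphs and Lebesgue measure in the plane *)

Lemma diam_le (R : realType) (T : Type) (dist : T -> T -> R) (U : set T) (d : R) :
  0 <= d -> (forall p q, U p -> U q -> dist p q <= d) -> (diam dist U <= d%:E)%E.
Proof.
move=> d0 Ud; rewrite /diam ge_max lee_fin d0 /=; apply: ge_ereal_sup.
by move=> _ [[p q] [/= Up Uq] <-]; rewrite lee_fin Ud.
Qed.

Lemma le_diam (R : realType) (T : Type) (dist : T -> T -> R) (U : set T) p q :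
  U p -> U q -> ((dist p q)%:E <= diam dist U)%E.
Proof.
move=> Up Uq; rewrite /diam le_max; apply/orP; right.
by apply: ereal_sup_ubound; exists (p, q).
Qed.

Lemma euclidean_dist_le (R : realType) (p q : R * R) :
  euclidean_dist p q <= `|p.1 - q.1| + `|p.2 - q.2|.
Proof.
rewrite /euclidean_dist -[leRHS]ger0_norm ?addr_ge0// -[leRHS]sqrtr_sqr ler_wsqrtr//.
rewrite [leRHS]sqrrD !real_normK ?num_real// -addrA lerD2l lerDr.
by rewrite mulrn_wge0// mulr_ge0.
Qed.

Lemma euclidean_dist_ge1 (R : realType) (p q : R * R) :
  `|p.1 - q.1| <= euclidean_dist p q.
Proof. by rewrite -sqrtr_sqr /euclidean_dist ler_wsqrtr// lerDl sqr_ge0. Qed.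

Lemma euclidean_dist_ge2 (R : realType) (p q : R * R) :
  `|p.2 - q.2| <= euclidean_dist p q.
Proof. by rewrite -sqrtr_sqr /euclidean_dist ler_wsqrtr// lerDr sqr_ge0. Qed.

(** Cut the y-axis into N equal intervals: the set falls into N pieces of
    diameter C / N, whose total weight C^s N^(1 - s) tends to 0. *)
Lemma lipschitz_graph_hausdorff_null (R : realType) (K a b s : R) (A : set (R * R)) :
  1 < s -> 0 <= K -> a < b -> (forall p, A p -> a <= p.2 < b) ->
  (forall p q, A p -> A q -> `|p.1 - q.1| <= K * `|p.2 - q.2|) ->
  hausdorff_null euclidean_dist s A.
Proof.
move=> s1 K0 ab Aab AK delta eps delta0 eps0.
pose C := (K + 1) * (b - a).
have C0 : 0 < C by rewrite mulr_gt0; lra.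
have s10 : 0 < s - 1 by lra.
(* Below eta the weight x^s is at most (eps / C) x, and the N pieces of
   diameter x = C / N weigh at most eps in all. *)
pose eta := Num.min delta ((eps / C) `^ (s - 1)^-1).
have eta0 : 0 < eta by rewrite lt_min delta0 powR_gt0// divr_gt0.
pose N := (Num.truncn (C / eta)).+1.
have N0 : 0 < N%:R :> R by rewrite ltr0n.
pose l := (b - a) / N%:R.
have l0 : 0 < l by rewrite divr_gt0; lra.
pose x := C / N%:R.
have x0 : 0 < x by rewrite divr_gt0.
have xeta : x <= eta.
  by rewrite /x ler_pdivrMr// mulrC -ler_pdivrMr// ltW// truncnS_gt.
have xs : x `^ s <= x * (eps / C).
  rewrite -[X in _ `^ X](subrKC 1) powRD; last by rewrite (gt_eqF x0) implybT.
  rewrite powRr1 ?ler_wpM2l ?(ltW x0)//.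
  have e0 : 0 <= eps / C by rewrite ltW// divr_gt0.
  have -> : eps / C = ((eps / C) `^ (s - 1)^-1) `^ (s - 1).
    by rewrite -powRrM mulVf ?powRr1 ?gt_eqF.
  apply: ge0_ler_powR; rewrite ?nnegrE ?(ltW x0) ?powR_ge0 ?(ltW s10)//.
  by rewrite (le_trans xeta)// ge_min lexx orbT.
(* Empty for j >= N. *)
pose U j := A `&` [set p | a + j%:R * l <= p.2 < a + j.+1%:R * l].
have UE j : (N <= j)%N -> U j = set0.
  move=> Nj; apply/seteqP; split => // p [/Aab/andP[_ pb] /= /andP[+ _]].
  rewrite leNgt => /negP; apply; rewrite (lt_le_trans pb)//.
  rewrite -lerBlDl /l mulrA ler_pdivlMr// mulrC ler_wpM2r ?ler_nat//; lra.
have dU j : (diam euclidean_dist (U j) <= x%:E)%E.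
  apply: diam_le => [|p q [Ap /= /andP[p1 p2]] [Aq /= /andP[q1 q2]]]; first exact: ltW.
  rewrite (le_trans (euclidean_dist_le _ _ _))//.
  have pql : `|p.2 - q.2| <= l.
    by rewrite -natr1 in p2 q2; rewrite ler_norml; apply/andP; split; lra.
  have -> : x = K * l + l by rewrite /x /C /l; ring.
  by rewrite lerD// (le_trans (AK _ _ Ap Aq))// ler_wpM2l.
exists U; split.
- move=> p Ap; have /andP[ap pb] := Aab _ Ap.
  have pl : 0 <= (p.2 - a) / l by rewrite divr_ge0 ?(ltW l0)//; lra.
  exists (Num.truncn ((p.2 - a) / l)) => //; split => //=.
  have /andP[t1 t2] := truncn_itv pl.
  by rewrite -lerBrDl -ler_pdivlMr// t1 -ltrBlDl -ltr_pdivrMr.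
- by move=> j; rewrite (le_trans (dU j))// lee_fin (le_trans xeta)// ge_min lexx.
- rewrite (nneseries_split 0 N)//; last by move=> j _; exact: hausdorff_weight_ge0.
  rewrite [X in (_ + X)%E]eseries0; last first.
    by move=> j + _; rewrite add0n => Nj; rewrite /hausdorff_weight UE// eqxx.
  rewrite adde0 add0n.
  apply: (@le_trans _ _ (\sum_(0 <= j < N) (x * (eps / C))%:E)%E).
    apply: lee_sum => j _; rewrite /hausdorff_weight; case: ifP => _.
      by rewrite lee_fin mulr_ge0 ?(ltW x0)// ltW// divr_gt0.
    rewrite (@le_trans _ _ (x%:E `^ s)%E)//.
      apply: gt0_ler_poweR => //; rewrite ?in_itv/= ?leey ?andbT; first by lra.
        by rewrite /diam le_max lexx.
      by rewrite lee_fin ltW.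
  rewrite sumEFin lee_fin sumr_const_nat subn0 -mulr_natl.
  by rewrite /x le_eqVlt; apply/orP; left; apply/eqP; field; rewrite !gt_eqF.
Qed.

(** A set of diameter d lies in a square of side 2 d centred at one of its
    points, of area 4 d^2. *)
Lemma diam_square_cover (R : realType) (V : set (R * R)) :
  (diam euclidean_dist V <= 1)%E ->
  exists Q : set (R * R), [/\ measurable Q, V `<=` Q &
    ((lebesgue_measure \x lebesgue_measure) Q <=
      4%:E * hausdorff_weight euclidean_dist 2 V)%E].
Proof.
move=> dV; have [->|/set0P/[dup] V0 [p Vp]] := eqVneq V set0.
  exists set0; split => //.
  by rewrite measure0 mule_ge0// hausdorff_weight_ge0.
pose d := fine (diam euclidean_dist V).
have d0 : (0 <= diam euclidean_dist V)%E by rewrite /diam le_max lexx.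
have dE : diam euclidean_dist V = d%:E.
  by rewrite fineK// ge0_fin_numE// (le_lt_trans dV)// ltry.
have d0' : 0 <= d by rewrite -lee_fin -dE.
pose I (c : R) : set R := `[c - d, c + d]%classic.
exists (I p.1 `*` I p.2); split.
- by apply: measurableX; exact: measurable_itv.
- move=> q Vq; have := le_diam _ _ euclidean_dist _ _ _ Vp Vq; rewrite dE lee_fin => pq.
  have := le_trans (euclidean_dist_ge1 _ p q) pq.
  have := le_trans (euclidean_dist_ge2 _ p q) pq.
  rewrite !ler_norml => /andP[? ?] /andP[? ?].
  by split; rewrite /I /= in_itv/=; apply/andP; split; lra.
- have mI c : lebesgue_measure (I c) = (2 * d)%:E.
    rewrite /I lebesgue_measure_itv/= lte_fin; case: ifPn => [_|].
      by rewrite -EFinB; congr EFin; ring.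
    by rewrite -leNgt => ?; congr EFin; lra.
  have -> : (lebesgue_measure \x lebesgue_measure)%E (I p.1 `*` I p.2) =
      (lebesgue_measure (I p.1) * lebesgue_measure (I p.2))%E.
    by apply: product_measure1E; exact: measurable_itv.
  rewrite !mI /hausdorff_weight; case: eqP => [V0'|_].
    by move: V0; rewrite V0' => -[].
  rewrite dE poweR_EFin powR_mulrn// -!EFinM lee_fin.
  by rewrite le_eqVlt; apply/orP; left; apply/eqP; ring.
Qed.

Lemma hausdorff_null2_negligible (R : realType) (E : set (R * R)) :
  hausdorff_null euclidean_dist 2 E ->
  (lebesgue_measure \x lebesgue_measure)%E.-negligible E.
Proof.
move=> nE; set mu2 := (lebesgue_measure \x lebesgue_measure)%E.
have cov (n : nat) : exists B : set (R * R), [/\ measurable B, E `<=` B &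
    (mu2 B <= (4 / n.+1%:R)%:E)%E].
  have [U [EU dU sU]] := nE 1 n.+1%:R^-1 ltr01 ltac:(by rewrite invr_gt0).
  have /choice[Q HQ] : forall i, exists Q : set (R * R), [/\ measurable Q, U i `<=` Q &
      (mu2 Q <= 4%:E * hausdorff_weight euclidean_dist 2 (U i))%E].
    by move=> i; exact: diam_square_cover.
  have mQ i : measurable (Q i) by have [] := HQ i.
  have mUQ : measurable (\bigcup_i Q i) by exact: bigcupT_measurable.
  exists (\bigcup_i Q i); split => //.
    by move=> p /EU[i _ Up]; exists i => //; have [_ + _] := HQ i; apply.
  apply: (le_trans (measure_sigma_subadditive mu2 mQ mUQ (@subset_refl _ _))).
  apply: (@le_trans _ _ (\sum_(0 <= i <oo) 4%:E * hausdorff_weight euclidean_dist 2 (U i))%E).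
    by apply: lee_nneseries => // i _; have [] := HQ i.
  rewrite nneseriesZl; last by move=> i _; exact: hausdorff_weight_ge0.
  by rewrite EFinM lee_wpmul2l.
have /choice[B HB] := cov.
have mB i : measurable (B i) by have [] := HB i.
have mIB : measurable (\bigcap_n B n) by exact: bigcapT_measurable.
exists (\bigcap_n B n); split => //; last first.
  by move=> p Ep n _; have [_ + _] := HB n; apply.
apply/eqP; rewrite eq_le measure_ge0 andbT; apply/lee_addgt0Pr => e e0.
rewrite add0e; pose n := Num.truncn (4 / e).
have [_ _ Bn] := HB n.
apply: (@le_trans _ _ (mu2 (B n))).
  apply: le_measure; rewrite ?inE//.
    exact: mB.
  by move=> p; exact.
rewrite (le_trans Bn)// lee_fin ler_pdivrMr ?ltr0n// mulrC -ler_pdivrMr//.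
by rewrite ltW// truncnS_gt.
Qed.

(** * From Hermite coefficients to Gaussian moments *)

Lemma hermite1 (R : realType) (x : R) : hermite 1 x = x.
Proof.
have d2 : is_derive x 1 (fun t : R => - (t ^+ 2 / 2)) (- x).
  by apply: is_derive_eq; rewrite /GRing.scale /=; field.
have d3 := is_derive1_comp (is_derive_expR _) d2.
rewrite /hermite /= derive1E (@derive_val _ _ _ _ _ _ _ d3) expr1.
by rewrite mulN1r mulrN mulrNN mulrA expRxMexpNx_1 mul1r.
Qed.

(** The coefficient of order 1 would make the rank 1. *)
Lemma hermite_rank_ge2 (R : realType) (f : R -> R) :
  (2%:E <= hermite_rank f)%E ->
  (\int[normal_prob 0 1]_x (f x * x)%:E = 0)%E.
Proof.
move=> f2; apply: contrapT => f1.
have : (hermite_rank f <= 1%:R%:E)%E.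
  apply: ereal_inf_lbound; exists 1%N => //; split => //.
  by under eq_integral do rewrite hermite1.
by move=> /(le_trans f2); rewrite lee_fin ler_nat.
Qed.

Lemma measurable_rescale (R : realType) (G : R -> R) (x y : R) :
  measurable_fun setT G -> measurable_fun setT (rescale G x y).
Proof.
move=> mG; apply: (measurableT_comp mG).
by apply: measurable_funD => //; exact: measurable_funM.
Qed.

Lemma normal_pdf01E (R : realType) (x y u : R) : y != 0 ->
  normal_pdf 0 1 ((u - x) / y) = normal_peak 1 * gauss_kernel 0 x y u.
Proof.
move=> y0; rewrite normal_pdfE ?oner_neq0// /normal_fun /gauss_kernel expr0 mul1r subr0.
by congr (_ * expR _); rewrite -mulr_natr; field.
Qed.

(** Square integrability against a normal law of standard deviation s yields
    integrability against the faster decaying weight by the inequality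
    2 |G| e1 e2 <= (|G| e1)^2 + e2^2. *)
Lemma Lfun2_rescale_integrable (R : realType) (G : R -> R) (M s : R) :
  0 < s -> measurable_fun setT G ->
  rescale G M s \in Lfun (normal_prob 0 1) 2%:E ->
  lebesgue_measure.-integrable setT
    (EFin \o (fun u => `|G u| * expR (- (3 / 4 * (2 * s ^+ 2)^-1 * u ^+ 2)))).
Proof.
move=> s0 mG L2; have sn0 : s != 0 by rewrite gt_eqF.
set b := (2 * s ^+ 2)^-1.
have b0 : 0 < b by rewrite invr_gt0 mulr_gt0// exprn_gt0.
pose F u := G u ^+ 2 * (normal_peak 1 * gauss_kernel 0 M s u).
have peak0 : 0 < normal_peak (1 : R) by rewrite normal_peak_gt0// oner_neq0.
have k0 u : 0 <= gauss_kernel 0 M s u by rewrite /gauss_kernel expr0 mul1r expR_ge0.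
have F0 u : 0 <= F u by rewrite mulr_ge0 ?sqr_ge0// mulr_ge0// ltW.
have mF : measurable_fun setT F.
  apply: measurable_funM; first exact: measurable_funX.
  by apply: measurable_funM => //; exact: measurable_gauss_kernel.
have iF : lebesgue_measure.-integrable setT (EFin \o F).
  apply/integrableP; split; first exact/measurable_EFinP.
  have /integrableP[_] := Lfun2_integrable_sqr L2.
  under eq_integral do rewrite /= ger0_norm ?sqr_ge0//.
  rewrite ge0_integral_normal_prob; last 2 first.
  - by apply/measurable_EFinP; apply: measurable_funX; exact: measurable_rescale.
  - by move=> x; rewrite lee_fin sqr_ge0.
  have FE z : ((rescale G M s z ^+ 2)%:E * (normal_pdf 0 1 z)%:E = (EFin \o F) (M + s * z)%R)%E.
    rewrite -EFinM /= /F -normal_pdf01E// (_ : (M + s * z - M) / s = z)//.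
    by field.
  under eq_integral do rewrite FE.
  rewrite ge0_integral_affine//; last exact/measurable_EFinP.
  under [X in _ -> (X < _)%E]eq_integral do rewrite /= ger0_norm//.
  move=> h; rewrite -[X in (X < _)%E]mul1e -(mulfV sn0) EFinM -muleA.
  by rewrite lte_mul_pinfty// lee_fin ltW.
have iE := integrable_expR_Nsqr R (b / 4) ltac:(lra).
pose C := (normal_peak 1)^-1 * expR (5 * b * M ^+ 2).
have C0 : 0 < C by rewrite mulr_gt0 ?expR_gt0// invr_gt0.
apply: le_integrable (integrableD measurableT (integrableZl measurableT C iF) iE) => //.
  apply/measurable_EFinP; apply: measurable_funM; first exact: measurableT_comp.
  apply: measurableT_comp => //; apply: measurableT_comp => //.
  by apply: measurable_funM => //; exact: measurable_funX.
move=> u _ /=; rewrite lee_fin [leLHS]ger0_norm ?mulr_ge0 ?expR_ge0//.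
rewrite [leRHS]ger0_norm; last by rewrite addr_ge0 ?expR_ge0// mulr_ge0 ?(ltW C0).
(* The exponent 5/4 b pays for the shift: (u - M)^2 <= 5/4 u^2 + 5 M^2. *)
have h1 : G u ^+ 2 * expR (- (5 / 4 * b * u ^+ 2)) <= C * F u.
  have -> : C * F u = G u ^+ 2 * (expR (5 * b * M ^+ 2) * gauss_kernel 0 M s u).
    by rewrite /C /F; field; rewrite gt_eqF.
  rewrite ler_wpM2l ?sqr_ge0// /gauss_kernel expr0 mul1r -expRD ler_expR.
  rewrite (_ : (u - M) ^+ 2 / (2 * s ^+ 2) = b * (u - M) ^+ 2); last by rewrite mulrC.
  by have := sqr_ge0 (u / 2 + 2 * M); nra.
apply: (le_trans _ (lerD h1 (lexx _))).
(* The exponents 5/8 and 1/8 add up to 3/4, and their doubles are those of the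
   two integrable functions. *)
set e1 := expR (- (5 / 8 * b * u ^+ 2)).
set e2 := expR (- (1 / 8 * b * u ^+ 2)).
have -> : expR (- (5 / 4 * b * u ^+ 2)) = e1 ^+ 2.
  by rewrite /e1 -expRM_natl; congr expR; field.
have -> : expR (- (b / 4 * u ^+ 2)) = e2 ^+ 2.
  by rewrite /e2 -expRM_natl; congr expR; field.
have -> : expR (- (3 / 4 * b * u ^+ 2)) = e1 * e2.
  by rewrite /e1 /e2 -expRD; congr expR; field.
rewrite -(real_normK (num_real (G u))).
have : 0 <= e1 * e2 by rewrite mulr_ge0 ?expR_ge0.
have := sqr_ge0 (`|G u| * e1 - e2).
have : 0 <= `|G u| * (e1 * e2) by rewrite !mulr_ge0 ?expR_ge0.
by move=> *; nra.
Qed.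

(** Substitute u = x + y z. *)
Lemma gauss_moment1_eq0 (R : realType) (G : R -> R) (x y : R) :
  0 < y -> measurable_fun setT G ->
  lebesgue_measure.-integrable setT (EFin \o (fun u => G u * gauss_kernel 1 x y u)) ->
  (\int[normal_prob 0 1]_z (rescale G x y z * z)%:E = 0)%E ->
  gauss_moment G 1 x y = 0.
Proof.
move=> y0 mG iG; have yn0 : y != 0 by rewrite gt_eqF.
rewrite integral_normal_prob; last by apply: measurable_funM => //; exact: measurable_rescale.
pose K : R := normal_peak 1 / y.
have K0 : 0 < K by rewrite divr_gt0// normal_peak_gt0// oner_neq0.
pose f u := K * (G u * gauss_kernel 1 x y u).
have fE z : rescale G x y z * z * normal_pdf 0 1 z = f (x + y * z).
  have {2 3}-> : z = (x + y * z - x) / y by field.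
  rewrite normal_pdf01E// /f /K /rescale /gauss_kernel expr0 expr1.
  by field.
under eq_integral do rewrite fE.
have iF : lebesgue_measure.-integrable setT (EFin \o f).
  rewrite (_ : EFin \o f = (fun u => K%:E * (G u * gauss_kernel 1 x y u)%:E)%E).
    exact: integrableZl.
  by apply/funext => u /=; rewrite -EFinM.
rewrite integral_affine// => /(congr1 fine).
rewrite fineM//; last exact: (integrable_fin_num measurableT iF).
rewrite -/(Rintegral lebesgue_measure setT f) /f RintegralZl// => /eqP.
by rewrite mulf_eq0 invr_eq0 (gt_eqF y0) mulf_eq0 (gt_eqF K0) => /eqP.
Qed.

(** * The set of zeros *)

Lemma exists_invn_le (R : realType) (y : R) : 0 < y -> exists n, n.+1%:R^-1 <= y.
Proof.
move=> y0; exists (Num.truncn y^-1).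
by rewrite invf_ple ?posrE ?ltr0n// ltW// truncnS_gt.
Qed.

Section zero_set.
Context {R : realType} (G : R -> R) (c Y : R).
Hypotheses (c0 : 0 < c) (Y0 : 0 < Y) (cY : c < (2 * Y ^+ 2)^-1).
Hypothesis mG : measurable_fun setT G.
Hypothesis iG : lebesgue_measure.-integrable setT
  (EFin \o (fun u => `|G u| * expR (- (c * u ^+ 2)))).

(** The index k + 1 is the first one with a nonzero gradient moment.  For k = 0 the
    second equation repeats the first; it is multiplied by k wherever it is used. *)
Lemma gradient_moment_finite_order (x y : R) :
  ~ (exists kappa, {ae lebesgue_measure, forall u, G u = kappa}) ->
  0 < y -> y < Y -> gradient_moment G 0 x y = 0 ->
  exists k, [/\ gradient_moment G k x y = 0, gradient_moment G k.-1 x y = 0 &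
    gradient_moment G k.+1 x y != 0].
Proof.
move=> ncG y0 yY g0.
have ex : exists k, gradient_moment G k x y != 0.
  apply: contrapT => /forallNP gk; apply: ncG.
  apply: (gradient_moment_all0 G c Y c0 Y0 cY mG iG x y y0 yY) => k.
  by apply/eqP/negbNE/negP; exact: gk.
case: (ex_minnP ex) => -[|k]; first by rewrite g0 eqxx.
move=> gk min_k; exists k; split => //; apply/eqP/negbNE/negP => /min_k.
  by rewrite ltnn.
by rewrite ltnNge (leq_trans (leq_pred k)).
Qed.

(** On vertical strips of width r the set satisfies a Lipschitz condition. *)
Lemma gradient_moment_zeros_hausdorff_null (s M a m : R) k : 1 < s -> 0 < a -> 0 < m ->
  hausdorff_null euclidean_dist s [set p | [/\ `|p.1| <= M, a <= p.2 < Y,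
    gradient_moment G k p.1 p.2 = 0, gradient_moment G k.-1 p.1 p.2 = 0 &
    m <= `|gradient_moment G k.+1 p.1 p.2| ] ].
Proof.
move=> s1 a0 m0; set S := [set p | _].
have [r r0 [K HK]] := gradient_moment_zeros_graph G c Y c0 Y0 cY mG iG k M a m a0 m0.
pose strip i := S `&` [set p | - M + i%:R * r <= p.1 < - M + i.+1%:R * r].
apply: (@hausdorff_null_sub _ _ _ _ _ (\bigcup_i strip i)).
  move=> p Sp; have [pM _ _ _ _] := Sp.
  have pr : 0 <= (p.1 + M) / r.
    by rewrite divr_ge0 ?(ltW r0)//; move: pM; rewrite ler_norml => /andP[? _]; lra.
  exists (Num.truncn ((p.1 + M) / r)) => //; split => //=.
  have /andP[t1 t2] := truncn_itv pr.
  by rewrite !(addrC (- M)) lerBlDr -ler_pdivlMr// t1 ltrBrDr -ltr_pdivrMr.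
apply: hausdorff_null_bigcup => i.
apply: (@lipschitz_graph_hausdorff_null _ `|K| 0 Y) => //.
  by move=> p [[_ /andP[ap pY] _ _ _] _]; rewrite pY (le_trans (ltW a0)).
move=> p q [[pM /andP[ap pY] gp gp1 gpm] /= /andP[p1 p2]].
move=> [[qM /andP[aq qY] gq _ _] /= /andP[q1 q2]].
have pqr : `|p.1 - q.1| <= r.
  by rewrite -natr1 in p2 q2; rewrite ler_norml; apply/andP; split; lra.
apply: (le_trans (HK _ _ _ _ pM qM ap pY aq qY gp gp1 gpm gq pqr)).
by rewrite ler_wpM2r// ler_norm.
Qed.

(** Stratify the zeros by their order k in x, by their distance to y = 0 and by
    the size of the first gradient moment that does not vanish. *)
Lemma gauss_moment1_zeros_hausdorff_null (s M : R) :
  ~ (exists kappa, {ae lebesgue_measure, forall u, G u = kappa}) -> 1 < s ->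
  hausdorff_null euclidean_dist s [set p | [/\ - M < p.1 < M, 0 < p.2 < Y &
    gauss_moment G 1 p.1 p.2 = 0] ].
Proof.
move=> ncG s1.
apply: (@hausdorff_null_sub _ _ _ _ _ (\bigcup_k \bigcup_n \bigcup_m
  [set p | [/\ `|p.1| <= M, n.+1%:R^-1 <= p.2 < Y,
    gradient_moment G k p.1 p.2 = 0, gradient_moment G k.-1 p.1 p.2 = 0 &
    m.+1%:R^-1 <= `|gradient_moment G k.+1 p.1 p.2| ] ])).
  move=> p [/andP[pM1 pM2] /andP[p0 pY] gp].
  have g0 : gradient_moment G 0 p.1 p.2 = 0.
    by rewrite /gradient_moment gp !mul0r subrr.
  have [k [gk gk1 gkS]] := gradient_moment_finite_order p.1 p.2 ncG p0 pY g0.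
  have [n np] := exists_invn_le R p.2 p0.
  have [m mp] := exists_invn_le R `|gradient_moment G k.+1 p.1 p.2| ltac:(by rewrite normr_gt0).
  exists k => //; exists n => //; exists m => //; split => //.
    by rewrite ler_norml !ltW.
  by rewrite np.
apply: hausdorff_null_bigcup => k; apply: hausdorff_null_bigcup => n.
apply: hausdorff_null_bigcup => m.
by apply: gradient_moment_zeros_hausdorff_null => //; rewrite invr_gt0.
Qed.

End zero_set.

Theorem theorem2p5 (R : realType) (M1 M2 : R) (G : R -> R)
    (hM1 : 0 < M1) (hM2 : 0 < M2)
    (mG : measurable_fun [set: R] G)
    (ncG : ~ exists c : R, {ae lebesgue_measure, forall x : R, G x = c})
    (L2p : rescale G M1 M2 \in Lfun (normal_prob 0 1) 2%:E)
    (L2m : rescale G (- M1) M2 \in Lfun (normal_prob 0 1) 2%:E) :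
  let E : set (R * R) :=
    [set p : R * R | [/\ - M1 < p.1 < M1, 0 < p.2 < M2 &
                     (2%:E <= hermite_rank (rescale G p.1 p.2))%E]] in
  (hausdorff_dim euclidean_dist E <= 1)%E /\
  (lebesgue_measure \x lebesgue_measure)%E.-negligible E.
Proof.
move=> E; pose b := (2 * M2 ^+ 2)^-1.
have b0 : 0 < b by rewrite invr_gt0 mulr_gt0// exprn_gt0.
have c0 : 0 < 3 / 4 * b by rewrite mulr_gt0.
have cb : 3 / 4 * b < (2 * M2 ^+ 2)^-1 by rewrite -/b; lra.
have iG := Lfun2_rescale_integrable R G M1 M2 hM2 mG L2p.
have nE s : 1 < s -> hausdorff_null euclidean_dist s E.
  move=> s1; apply: hausdorff_null_sub
    (gauss_moment1_zeros_hausdorff_null G (3 / 4 * b) M2 c0 hM2 cb mG iG s M1 ncG s1).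
  move=> p [pM /[dup] pY /andP[p0 p2] /hermite_rank_ge2 hp]; split => //.
  apply: gauss_moment1_eq0 => //.
  exact: (integrable_gauss_moment G (3 / 4 * b) M2 c0 hM2 cb mG iG).
split; first exact: hausdorff_dim_le.
by apply: hausdorff_null2_negligible; apply: nE; rewrite ltr1n.
Qed.
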